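(* Let $Y$ be the bounded strong solution of the put-side obstacle problem on $(\ln k_2,\infty)\times(0,T]$, with free boundaries $\widetilde A,\widetilde B$ on $(0,T]$ and $\widetilde B(0):=\lim_{\tau\searrow0}\widetilde B(\tau)$. Let $\widetilde V$ be the strong solution of the capped stationary put-side problem, with upper free boundary $\widetilde a$ and inner boundary level $\widetilde b_{k_2}$, as defined in the context. Then $$\begin{cases}Y(x,\tau)\le\widetilde V(x),&(x,\tau)\in[\ln k_2,+\infty)\times[0,T],\\ \ln K_2<\widetilde A(\tau)\le\widetilde a,&\tau\in(0,T],\\ \widetilde b_{k_2}\le\widetilde B(\tau)\le\widetilde B(0),&\tau\in(0,T].\end{cases}$$
   Context: Constants: $0<K_1<k_1<k_2<K_2$, $\sigma>0$, $r>0$, $q\ge0$, $T>0$. Put $\mathcal Lu:=\frac{\sigma^2}{2}\partial_{xx}u+\left(r-q-\frac{\sigma^2}{2}\right)\partial_xu-ru$ and $\psi_2(x):=(K_2-e^x)^++k_2-K_1$. $n_1<0<n_2$ are the roots of $\frac{\sigma^2}{2}n^2+\left(r-q-\frac{\sigma^2}{2}\right)n-r=0$. Evolution problem. Let $Q=(\ln k_2,\infty)\times(0,T]$. For $1<p<\infty$, $\mathcal W_p(Q)$ is the set of $u\in C([\ln k_2,\infty)\times[0,T])$ such that, for all $R,\rho>0$, $u,\partial_xu,\partial_{xx}u,\partial_\tau u$ (weak derivatives) belong to $L^p$ of $\left(((\ln k_2,\infty)\cap(-R,R))\times(0,T)\right)\setminus B_\rho(\ln K_2,0)$ ($B_\rho$: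 open disc of radius $\rho$). A strong solution of the put-side obstacle problem is $Y\in\mathcal W_p(Q)$ with $Y\ge\psi_2$ in $Q$, $\partial_\tau Y-\mathcal LY\ge0$ a.e. in $Q$, $\partial_\tau Y-\mathcal LY=0$ a.e. on $\{Y>\psi_2\}$, $Y(x,0)=\psi_2(x)$ for $x>\ln k_2$, and $Y(\ln k_2,\tau)=K_2-K_1$ for $\tau\in[0,T]$. For every $p$ there is exactly one bounded strong solution, independent of $p$. Free boundaries, for $\tau\in(0,T]$: $\widetilde A(\tau)=\min\{x\ge\ln K_2:Y(x,\tau)=k_2-K_1\}$ and $\widetilde B(\tau)=\max\{x\in[\ln k_2,\ln K_2]:Y(x,\tau)=K_2-e^x+k_2-K_1\}$ (both attained). Stationary problem. A strong solution of the capped stationary put-side problem is a bounded $V\in C([\ln k_2,\infty))\cap W^2_{p,\mathrm{loc}}((\ln k_2,\infty))$ with $V\ge\psi_2$, $-\mathcal LV\ge0$ a.e., $-\mathcal LV=0$ a.e. on $\{V>\psi_2\}$ and $V(\ln k_2)=K_2-K_1$; it is unique and denoted $\widetilde V$. Explicitly, let $G(u):=\frac{k_2-K_1}{n_2-n_1}\left[n_2e^{n_1u}-n_1e^{n_2u}\right]$, let $\widetilde y$ be the unique root in $(0,1)$ of $\widetilde f(z)=\frac{k_2-K_1}{n_2-n_1}\left[n_2(1-n_1)z^{n_1}+n_1(n_2-1)z^{n_2}\right]-(K_2+k_2-K_1)$, and $e^{\widetilde b}=-\frac{(k_2-K_1)n_1n_2}{n_2-n_1}\left[\widetilde y^{\,n_1}-\widetilde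 y^{\,n_2}\right]$. If $\widetilde b\ge\ln k_2$: $e^{\widetilde a}:=e^{\widetilde b}/\widetilde y$, $\widetilde b_{k_2}:=\widetilde b$, and $\widetilde V(x)=K_2-e^x+k_2-K_1$ for $\ln k_2\le x<\widetilde b$, $\widetilde V(x)=G(x-\widetilde a)$ for $\widetilde b\le x\le\widetilde a$, $\widetilde V(x)=k_2-K_1$ for $x>\widetilde a$. If $\widetilde b<\ln k_2$: $e^{\widetilde a}:=k_2/z_0$, where $z_0$ is the unique root in $(0,1)$ of $\widetilde g(z)=\frac{k_2-K_1}{n_2-n_1}\left[n_2z^{n_1}-n_1z^{n_2}\right]-(K_2-K_1)$, $\widetilde b_{k_2}:=\ln k_2$, and $\widetilde V(x)=G(x-\widetilde a)$ for $\ln k_2\le x\le\widetilde a$, $\widetilde V(x)=k_2-K_1$ for $x>\widetilde a$. *)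

(* Defs.v *)
From HB Require Import structures.
From mathcomp Require Import all_boot all_order all_algebra.
From mathcomp Require Import all_classical all_reals all_analysis.

Set Implicit Arguments.
Unset Strict Implicit.
Unset Printing Implicit Defensive.

Import Order.TTheory GRing.Theory Num.Theory.
Import numFieldNormedType.Exports.

Local Open Scope classical_set_scope.
Local Open Scope ring_scope.

(* C^oo: every iterated directional derivative is differentiable everywhere. *)
Definition smooth {R : realType} {V : normedModType R} (phi : V -> R) : Prop :=
  forall (vs : seq V) (z : V),
    differentiable (foldr (fun v (f : V -> R) => 'D_v f) phi vs) z.

Definition test_function {R : realType} {V : normedModType R}
    (Omega : set V) (phi : V -> R) : Prop :=
  smooth phi /\
  exists K : set V, [/\ compact K, K `<=` Omega &
                        forall z, ~ K z -> phi z = 0].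

Definition lebesgue2 {R : realType} :=
  ((@lebesgue_measure R) \x (@lebesgue_measure R))%E.

(* [g] is the weak derivative of [f] on the open set [Omega].  The real-valued
   integrals are only meaningful when [f] and [g] are locally integrable on
   [Omega]; below this always follows from the accompanying L^p conditions. *)
Definition weak_derivative1 {R : realType} (Omega : set R) (f g : R -> R) : Prop :=
  forall phi : R -> R, test_function Omega phi ->
    \int[@lebesgue_measure R]_(x in Omega) (f x * derive1 phi x) =
    - \int[@lebesgue_measure R]_(x in Omega) (g x * phi x).

Definition weak_derivative2 {R : realType} (Omega : set (R * R)) (v : R * R)
    (f g : R * R -> R) : Prop :=
  forall phi : R * R -> R, test_function Omega phi ->
    \int[@lebesgue2 R]_(z in Omega) (f z * 'D_v phi z) =
    - \int[@lebesgue2 R]_(z in Omega) (g z * phi z).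

(* The restriction [f \_ D] is extended by [0] outside [D]. *)
Definition Lp_on d {T : measurableType d} {R : realType}
    (mu : {measure set T -> \bar R}) (p : R) (D : set T) (f : T -> R) : Prop :=
  f \_ D \in Lfun mu p%:E.

Definition x_dir {R : realType} : R * R := (1, 0).
Definition t_dir {R : realType} : R * R := (0, 1).

(* The value of L u at a point where u, u_x and u_xx take the values [u0], [u1], [u2]. *)
Definition L_op {R : realType} (sigma r q u0 u1 u2 : R) : R :=
  sigma ^+ 2 / 2 * u2 + (r - q - sigma ^+ 2 / 2) * u1 - r * u0.

Definition psi2 {R : realType} (K1 k2 K2 x : R) : R :=
  Num.max (K2 - expR x) 0 + k2 - K1.

(* Space-time points are pairs (x, tau). *)
Definition Q {R : realType} (k2 T : R) : set (R * R) :=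
  [set z | ln k2 < z.1 /\ 0 < z.2 <= T].

Definition Q_interior {R : realType} (k2 T : R) : set (R * R) :=
  [set z | ln k2 < z.1 /\ 0 < z.2 < T].

Definition Q_closed {R : realType} (k2 T : R) : set (R * R) :=
  [set z | ln k2 <= z.1 /\ 0 <= z.2 <= T].

(* The part of the strip with |x| < M lying outside the open Euclidean disc of
   radius [rho] around (ln K2, 0); [ball] on a product is a sup-norm ball, hence
   the explicit inequality. *)
Definition Q_cut {R : realType} (k2 K2 T M rho : R) : set (R * R) :=
  [set z | [/\ ln k2 < z.1, - M < z.1 < M, 0 < z.2 < T &
               rho ^+ 2 <= (z.1 - ln K2) ^+ 2 + z.2 ^+ 2]].

(* [u] belongs to W_p(Q), with weak derivatives [ux], [uxx], [ut]. *)
Definition in_Wp {R : realType} (k2 K2 T p : R) (u ux uxx ut : R * R -> R) : Prop :=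
  [/\ {within Q_closed k2 T, continuous u},
      weak_derivative2 (Q_interior k2 T) x_dir u ux,
      weak_derivative2 (Q_interior k2 T) x_dir ux uxx,
      weak_derivative2 (Q_interior k2 T) t_dir u ut &
      forall M rho : R, 0 < M -> 0 < rho ->
        [/\ Lp_on lebesgue2 p (Q_cut k2 K2 T M rho) u,
            Lp_on lebesgue2 p (Q_cut k2 K2 T M rho) ux,
            Lp_on lebesgue2 p (Q_cut k2 K2 T M rho) uxx &
            Lp_on lebesgue2 p (Q_cut k2 K2 T M rho) ut]].

Definition strong_solution {R : realType} (K1 k2 K2 sigma r q T p : R)
    (Y : R * R -> R) : Prop :=
  exists Yx Yxx Yt : R * R -> R,
  [/\ in_Wp k2 K2 T p Y Yx Yxx Yt,
      forall z, Q k2 T z -> psi2 K1 k2 K2 z.1 <= Y z,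
      {ae lebesgue2, forall z, Q k2 T z ->
        0 <= Yt z - L_op sigma r q (Y z) (Yx z) (Yxx z)},
      {ae lebesgue2, forall z, Q k2 T z -> psi2 K1 k2 K2 z.1 < Y z ->
        Yt z - L_op sigma r q (Y z) (Yx z) (Yxx z) = 0} &
      (forall x, ln k2 < x -> Y (x, 0) = psi2 K1 k2 K2 x) /\
      (forall tau, 0 <= tau <= T -> Y (ln k2, tau) = K2 - K1)].

Definition bounded_strong_solution {R : realType} (K1 k2 K2 sigma r q T p : R)
    (Y : R * R -> R) : Prop :=
  strong_solution K1 k2 K2 sigma r q T p Y /\
  exists M : R, forall z, Q_closed k2 T z -> `|Y z| <= M.

Definition is_min {R : realType} (S : set R) (m : R) : Prop := S m /\ lbound S m.
Definition is_max {R : realType} (S : set R) (m : R) : Prop := S m /\ ubound S m.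

Definition is_upper_boundary {R : realType} (K1 k2 K2 T : R) (Y : R * R -> R)
    (A : R -> R) : Prop :=
  forall tau, 0 < tau <= T ->
    is_min [set x | ln K2 <= x /\ Y (x, tau) = k2 - K1] (A tau).

Definition is_lower_boundary {R : realType} (K1 k2 K2 T : R) (Y : R * R -> R)
    (B : R -> R) : Prop :=
  forall tau, 0 < tau <= T ->
    is_max [set x | ln k2 <= x <= ln K2 /\ Y (x, tau) = K2 - expR x + k2 - K1]
      (B tau).

(* [V] belongs to W^2_{p,loc} of the open set [Omega], with weak derivatives
   [V1], [V2]. *)
Definition in_W2p_loc {R : realType} (Omega : set R) (p : R) (V V1 V2 : R -> R) : Prop :=
  [/\ weak_derivative1 Omega V V1,
      weak_derivative1 Omega V1 V2 &
      forall K : set R, compact K -> K `<=` Omega ->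
        [/\ Lp_on lebesgue_measure p K V,
            Lp_on lebesgue_measure p K V1 &
            Lp_on lebesgue_measure p K V2]].

Definition stationary_solution {R : realType} (K1 k2 K2 sigma r q p : R)
    (V : R -> R) : Prop :=
  [/\ {within [set x | ln k2 <= x], continuous V},
      exists M : R, forall x, ln k2 <= x -> `|V x| <= M,
      forall x, ln k2 <= x -> psi2 K1 k2 K2 x <= V x,
      V (ln k2) = K2 - K1 &
      exists V1 V2 : R -> R,
      [/\ in_W2p_loc [set x | ln k2 < x] p V V1 V2,
          {ae lebesgue_measure, forall x, ln k2 < x ->
            0 <= - L_op sigma r q (V x) (V1 x) (V2 x)} &
          {ae lebesgue_measure, forall x, ln k2 < x -> psi2 K1 k2 K2 x < V x ->
            - L_op sigma r q (V x) (V1 x) (V2 x) = 0}]].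

Definition char_root {R : realType} (sigma r q n : R) : Prop :=
  sigma ^+ 2 / 2 * n ^+ 2 + (r - q - sigma ^+ 2 / 2) * n - r = 0.

Definition f_tilde {R : realType} (K1 k2 K2 n1 n2 z : R) : R :=
  (k2 - K1) / (n2 - n1) *
    (n2 * (1 - n1) * z `^ n1 + n1 * (n2 - 1) * z `^ n2) - (K2 + k2 - K1).

Definition g_tilde {R : realType} (K1 k2 K2 n1 n2 z : R) : R :=
  (k2 - K1) / (n2 - n1) * (n2 * z `^ n1 - n1 * z `^ n2) - (K2 - K1).

(* [a] is the upper free boundary and [bk2] the inner boundary level of the
   capped stationary problem; [b] is the inner boundary of the uncapped one. *)
Definition stationary_boundaries {R : realType} (K1 k2 K2 n1 n2 a bk2 : R) : Prop :=
  exists y b : R,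
  [/\ 0 < y < 1, f_tilde K1 k2 K2 n1 n2 y = 0,
      expR b = - ((k2 - K1) * n1 * n2 / (n2 - n1)) * (y `^ n1 - y `^ n2),
      ln k2 <= b -> expR a = expR b / y /\ bk2 = b &
      b < ln k2 ->
        (exists z0 : R, [/\ 0 < z0 < 1, g_tilde K1 k2 K2 n1 n2 z0 = 0 &
                            expR a = k2 / z0]) /\
        bk2 = ln k2].

(* Main.v *)
Require Import Defs.
From HB Require Import structures.
From mathcomp Require Import all_boot all_order all_algebra.
From mathcomp Require Import all_classical all_reals all_analysis.
From mathcomp Require Import measurable_realfun ring lra.

(** The operator has constant coefficients, so mollification commutes with it.
    After mollification a strong solution [Y] becomes a smooth function on which
    [d/dtau - L] is nonnegative, and zero where [Y] exceeds the obstacle on the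
    support of the kernel. The zeroth order term of [L], with [r > 0], then
    excludes a positive interior maximum of the difference of [Y] and a
    supersolution lying above the obstacle, which yields a comparison principle
    up to a barrier [delta * exp (n2 x)] at infinity.

    Comparing [Y] with its own time translates shows that [Y] is nondecreasing
    in time, hence [B] is nonincreasing and has a limit at [0+]. Comparing [Y]
    with [V] gives [Y <= V]. The profile [G (x - a)], extended to the whole
    half-line, solves the stationary equation and stays above the obstacle, which
    it meets at [a] and [bk2]; hence [Y <= G (x - a)], which gives [A <= a] and
    [bk2 <= B]. Finally a steep parabola placed under the convex kink of the
    obstacle at [ln K2] is a subsolution, so [Y] exceeds the obstacle there and
    [ln K2 < A]. *)

Set Implicit Arguments.
Unset Strict Implicit.
Unset Printing Implicit Defensive.

Import Order.TTheory GRing.Theory Num.Theory.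
Import numFieldNormedType.Exports.

Local Open Scope classical_set_scope.
Local Open Scope ring_scope.

(** * Maximum principle *)

(** The derivatives of a strong solution are weak and lie in [L^p] for an arbitrary [p > 1], so a
    maximum point need not carry pointwise derivatives. The maximum principle is therefore run on
    smooth approximants and tolerates an error: all it needs is a sign of the operator at an
    approximate maximum. Two features of the problem shape the approximation. A parabolic maximum
    may sit at the final time, so the kernel must look strictly backward. The equation for [Y] may
    fail on the coincidence set, but the difference from a competitor above the obstacle is
    continuous, so near its positive maximum [Y] stays off that set. The bound by [V] does not by
    itself place the free boundaries, since [V] enters as any stationary solution and is not
    identified with the explicit formula. The explicit profile is compared with [Y] directly. Left
    uncut beyond [a] and below [bk2], it is a classical solution, so no derivatives have to be glued
    at a free boundary. *)

Definition heat_at {R : realType} (sigma r q : R) (F : R * R -> R) (z : R * R)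
    (v : R) : Prop :=
  exists (Ft : R) (F1 : R -> R) (F2 : R),
  [/\ is_derive z.2 (1 : R) (fun t => F (z.1, t)) Ft,
      forall x, is_derive x (1 : R) (fun x => F (x, z.2)) (F1 x),
      is_derive z.1 (1 : R) F1 F2 &
      v = Ft - L_op sigma r q (F z) (F1 z.1) F2].

Lemma heat_atB (R : realType) (sigma r q : R) (F G : R * R -> R) z v w :
  heat_at sigma r q F z v -> heat_at sigma r q G z w ->
  heat_at sigma r q (F \- G) z (v - w).
Proof.
move=> [Ft [F1 [F2 [dt dx dxx ->]]]] [Gt [G1 [G2 [et ex exx ->]]]].
exists (Ft - Gt), (F1 \- G1), (F2 - G2); split.
- exact: (is_deriveB dt et).
- by move=> x; exact: (is_deriveB (dx x) (ex x)).
- exact: is_deriveB.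
- by rewrite /L_op /=; ring.
Qed.

(** The explicit barriers all have this form: [k = 0] for stationary profiles, [k > 0] for the
    function that rises in time under the kink. *)
Lemma heat_at_sep (R : realType) (sigma r q : R) (g g1 : R -> R) (g2 k : R) z :
  (forall x, is_derive x (1 : R) g (g1 x)) -> is_derive z.1 (1 : R) g1 g2 ->
  heat_at sigma r q (fun z => g z.1 + k * z.2) z
    (k - L_op sigma r q (g z.1 + k * z.2) (g1 z.1) g2).
Proof.
move=> dg dg1; exists k, g1, g2; split => //=.
- have := is_deriveD (is_derive_cst (g z.1) z.2 1) (is_deriveZ k (is_derive_id z.2 (1 : R))).
  by rewrite add0r [k *: _]mulr1.
- move=> x.
  by have := is_deriveD (dg x) (is_derive_cst (k * z.2) x 1); rewrite addr0.
Qed.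

Lemma is_derive_quotientP (R : realType) (f : R -> R) (x d : R) :
  is_derive x (1 : R) f d -> forall e, 0 < e ->
  exists2 del, 0 < del & forall h, h != 0 -> `|h| < del ->
    `|d - (f (x + h) - f x) / h| < e.
Proof.
move=> [df <-] e e0.
have /cvgrPdist_lt/(_ _ e0) := df.
rewrite /dnbhs near_withinE => /nbhs_ballP[del /= del0 H].
exists del => // h h0 hd.
have := H h; rewrite /ball/= sub0r normrN => /(_ hd h0).
by rewrite /derive /= [h *: 1]mulr1 /GRing.scale/= mulrC [h + x]addrC.
Qed.

(** The maximum is taken over the past only, because a parabolic maximum may lie on the final time
    line. *)
Lemma derive_left_max (R : realType) (f : R -> R) (a x d : R) :
  is_derive x (1 : R) f d -> a < x -> (forall t, a < t <= x -> f t <= f x) ->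
  0 <= d.
Proof.
move=> df ax fmax; rewrite leNgt; apply/negP => d0.
have [|del del0 H] := is_derive_quotientP df (e := - d / 2); first by lra.
pose h := - (Num.min (del / 2) ((x - a) / 2)).
have hpos : 0 < - h by rewrite opprK lt_min; apply/andP; split; lra.
have h1 : - h <= del / 2 by rewrite opprK ge_min lexx.
have h2 : - h <= (x - a) / 2 by rewrite opprK ge_min lexx orbT.
have hne : h != 0 by lra.
have := H _ hne; rewrite ltr0_norm; last by lra.
move=> /(_ ltac:(lra)); rewrite ltr_norml => /andP[H1 _].
have := fmax (x + h) ltac:(lra).
have : (f (x + h) - f x) / h < 0 by lra.
rewrite ltr_ndivrMr; last by lra.
lra.
Qed.

(** A positive [d] would make [f1] positive just to the right of [c], and the mean value theorem
    would then produce a larger value of [f]. *)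
Lemma second_derive_max (R : realType) (f f1 : R -> R) (a b c d : R) :
  (forall x, is_derive x (1 : R) f (f1 x)) -> is_derive c (1 : R) f1 d ->
  a < c < b -> (forall t, a < t < b -> f t <= f c) -> f1 c = 0 /\ d <= 0.
Proof.
move=> df df1 acb fmax.
have f1c : f1 c = 0.
  have [_ <-] := df c.
  have H : is_derive c (1 : R) f 0.
    apply: (@derive1_at_max _ _ a b c); first by lra.
    - by move=> t tab; have [] := df t.
    - by rewrite in_itv.
    - by move=> t; rewrite in_itv/=; exact: fmax.
  by have [_ <-] := H.
split => //; rewrite leNgt; apply/negP => d0.
have [|del del0 H] := is_derive_quotientP df1 (e := d / 2); first by lra.
pose h := Num.min (del / 2) ((b - c) / 2).
have hpos : 0 < h by rewrite lt_min; apply/andP; split; lra.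
have h1 : h <= del / 2 by rewrite ge_min lexx.
have h2 : h <= (b - c) / 2 by rewrite ge_min lexx orbT.
have cch : c < c + h by lra.
have cf : {within `[c, c + h], continuous f}.
  by apply: derivable_within_continuous => x _; have [] := df x.
have [y] := MVT cch (fun x _ => df x) cf.
rewrite in_itv/= => ycb.
have y0 : y - c != 0 by lra.
have := H (y - c) y0; rewrite ger0_norm; last by lra.
have -> : c + (y - c) = y by ring.
move=> /(_ ltac:(lra)); rewrite f1c subr0 ltr_norml => /andP[_ H1].
have : 0 < f1 y / (y - c) by lra.
rewrite pmulr_lgt0; last by rewrite invr_gt0; lra.
move=> f1y.
have -> : c + h - c = h by ring.
have := fmax (c + h) ltac:(lra).
have : 0 < f1 y * h by rewrite mulr_gt0.
lra.
Qed.

(** The time derivative is nonnegative, the first space derivative vanishes and the second is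
    nonpositive, so only the zeroth order term [r * F z] remains as a lower bound. *)
Lemma heat_at_max (R : realType) (sigma r q a b t0 : R) (F : R * R -> R) z v :
  heat_at sigma r q F z v -> a < z.1 < b -> t0 < z.2 ->
  (forall x, a < x < b -> F (x, z.2) <= F z) ->
  (forall t, t0 < t <= z.2 -> F (z.1, t) <= F z) ->
  r * F z <= v.
Proof.
case: z => x t /= [Ft [F1 [F2 [/= dt dx dxx ->]]]] axb tt Hx Ht.
have Ft0 : 0 <= Ft by apply: (derive_left_max dt tt) => s /Ht.
have [-> F20] := second_derive_max dx dxx axb Hx.
rewrite /L_op.
have : 0 <= sigma ^+ 2 / 2 * - F2.
  by rewrite mulr_ge0 ?divr_ge0 ?sqr_ge0 // oppr_ge0.
lra.
Qed.

Definition box {R : realType} (xl xr tb te : R) : set (R * R) :=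
  [set z | xl <= z.1 <= xr /\ tb <= z.2 <= te].

Lemma box_compact (R : realType) (xl xr tb te : R) : compact (box xl xr tb te).
Proof.
have := compact_setX (@segment_compact R xl xr) (@segment_compact R tb te).
by congr compact; apply/seteqP; split => -[x t]; rewrite /box/= !in_itv.
Qed.

Lemma compact_unif_continuous (R : realType) (f : R * R -> R) (K : set (R * R))
    (e : R) :
  compact K -> continuous f -> 0 < e ->
  exists2 del, 0 < del & forall z z', K z -> `|z.1 - z'.1| <= del ->
    `|z.2 - z'.2| <= del -> `|f z - f z'| < e.
Proof.
move=> /compact_near_coveringP cK cf e0.
have := cK R (0^'+) (fun del z => forall z', `|z.1 - z'.1| <= del ->
    `|z.2 - z'.2| <= del -> `|f z - f z'| < e) _.
case=> [z Kz|].
  have e20 : 0 < e / 2 by lra.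
  have /cvgrPdist_lt/(_ _ e20) := cf z.
  case/nbhs_ballP => d /= d0 H.
  exists (ball z (d / 2), [set x | x < d / 2]).
    split; first by apply: nbhsx_ballx; rewrite divr_gt0.
    by apply: nbhs_right_lt; rewrite divr_gt0.
  move=> [z' del]/= [zz' deld] y zy1 zy2.
  have d2d : d / 2 <= d by rewrite ler_pdivrMr// ler_pMr// ler1n.
  have Hz' := H z' (le_ball d2d zz').
  have Hy : ball z d y.
    case: zz' => /= b1 b2; rewrite /ball/= in b1 b2.
    split; rewrite /ball/=.
      have -> : z.1 - y.1 = z.1 - z'.1 + (z'.1 - y.1) by ring.
      by apply: le_lt_trans (ler_normD _ _) _; lra.
    have -> : z.2 - y.2 = z.2 - z'.2 + (z'.2 - y.2) by ring.
    by apply: le_lt_trans (ler_normD _ _) _; lra.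
  have := H y Hy; move: Hz' => /=.
  have -> : f z' - f y = (f z - f y) - (f z - f z') by ring.
  by move=> ? ?; apply: le_lt_trans (ler_normB _ _) _; lra.
move=> U U0 H.
have [del [d0 Hd]] : exists del, 0 < del /\ K `<=` (fun z => forall z' : R * R,
    `|z.1 - z'.1| <= del -> `|z.2 - z'.2| <= del -> `|f z - f z'| < e).
  exists (U / 2); split; first by rewrite divr_gt0.
  apply: (H (U / 2)); last by rewrite divr_gt0.
  rewrite /ball/= sub0r normrN gtr0_norm; last by rewrite divr_gt0.
  by rewrite ltr_pdivrMr// ltr_pMr// ltr1n.
exists del => // z z' Kz; exact: Hd.
Qed.

(** Since [w] need not be differentiable, the contradiction is derived at a maximum of a smooth [F]
    close to [w]. The box is shrunk at the sides and the bottom, where [w] is small anyway, but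
    keeps its top, where a maximum may sit. The sign of the operator is only demanded where [w] is
    positive on a small backward box. *)
Lemma parabolic_comparison (R : realType) (sigma r q xl xr tb te : R)
    (w : R * R -> R) :
  0 < r -> continuous w ->
  (forall z, box xl xr tb te z -> [\/ z.1 = xl, z.1 = xr | z.2 = tb] ->
     w z <= 0) ->
  (forall eta, 0 < eta -> exists2 F : R * R -> R, continuous F &
     forall z, box (xl + eta) (xr - eta) (tb + eta) te z ->
       `|F z - w z| <= eta /\
       ((forall z', box (z.1 - eta) z.1 (z.2 - eta) z.2 z' -> 0 < w z') ->
         exists2 v, heat_at sigma r q F z v & v <= 0)) ->
  forall z, box xl xr tb te z -> w z <= 0.
Proof.
move=> r0 cw wbd Happ z0 Bz0; rewrite leNgt; apply/negP => wz0.
have cB := @box_compact R xl xr tb te.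
have [zm /set_mem Bzm wmax] : exists2 c, c \in box xl xr tb te &
    forall t, t \in box xl xr tb te -> w t <= w c.
  apply: compact_EVT_max => //; first by exists z0.
  exact: continuous_subspaceT.
set m := w zm.
have m0 : 0 < m by apply: lt_le_trans wz0 _; apply: wmax; exact/mem_set.
have [rho rho0 Hrho] := compact_unif_continuous cB cw (ltac:(lra) : 0 < m / 8).
(* The fractions of [m] leave room: where [F] is maximal, [w] is at least [m - m / 4], and a further
   oscillation of [m / 8] keeps it positive on the backward box and away from the parabolic
   boundary. *)
pose eta := Num.min rho (m / 8).
have eta0 : 0 < eta by rewrite lt_min rho0/=; lra.
have etarho : eta <= rho by rewrite ge_min lexx.
have etam : eta <= m / 8 by rewrite ge_min lexx orbT.
have near_bd z : box xl xr tb te z ->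
    [\/ z.1 <= xl + eta, xr - eta <= z.1 | z.2 <= tb + eta] -> w z < m / 8.
  move=> Bz Hz.
  have [z' [Bz' bz' d1 d2]] : exists z', [/\ box xl xr tb te z',
      [\/ z'.1 = xl, z'.1 = xr | z'.2 = tb], `|z.1 - z'.1| <= rho &
      `|z.2 - z'.2| <= rho].
    case: z Bz Hz => x t [/= Bx Bt]; case => /= H.
    - exists (xl, t); split => /=; [split=> /=; lra|by constructor 1| |].
        by rewrite ger0_norm; lra.
      by rewrite subrr normr0; lra.
    - exists (xr, t); split => /=; [split=> /=; lra|by constructor 2| |].
        by rewrite ler0_norm; lra.
      by rewrite subrr normr0; lra.
    - exists (x, tb); split => /=; [split=> /=; lra|by constructor 3| |].
        by rewrite subrr normr0; lra.
      by rewrite ger0_norm; lra.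
  have := Hrho z z' Bz d1 d2; have := wbd _ Bz' bz'.
  by move=> ?; rewrite ltr_norml => /andP[_]; lra.
have [F cF HF] := Happ _ eta0.
pose D := box (xl + eta) (xr - eta) (tb + eta) te.
have DB z : D z -> box xl xr tb te z.
  by case: z => x t; rewrite /D /box /= => -[? ?]; split; lra.
have Dzm : D zm.
  have Bzm' := Bzm; case: Bzm' => b1 b2.
  split.
    apply/andP; split; rewrite leNgt; apply/negP => H.
      by have := near_bd zm Bzm (Or31 _ _ (ltW H)); rewrite -/m; lra.
    by have := near_bd zm Bzm (Or32 _ _ (ltW H)); rewrite -/m; lra.
  apply/andP; split; last by case/andP: b2.
  rewrite leNgt; apply/negP => H.
  by have := near_bd zm Bzm (Or33 _ _ (ltW H)); rewrite -/m; lra.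
have [z1 /set_mem Dz1 Fmax] : exists2 c, c \in D & forall t, t \in D -> F t <= F c.
  apply: compact_EVT_max; [by exists zm|exact: box_compact|].
  exact: continuous_subspaceT.
have Fz1 : m - m / 8 <= F z1.
  apply: le_trans (Fmax _ (mem_set Dzm)).
  by have [+ _] := HF _ Dzm; rewrite ler_norml -/m => /andP[? _]; lra.
have [Hz1 Hv] := HF _ Dz1.
have wz1 : m - m / 4 <= w z1.
  by move: Hz1; rewrite ler_norml => /andP[_]; lra.
have Bz1 := DB _ Dz1.
have in1 : xl + eta < z1.1.
  by rewrite ltNge; apply/negP => H; have := near_bd z1 Bz1 (Or31 _ _ H); lra.
have in2 : z1.1 < xr - eta.
  by rewrite ltNge; apply/negP => H; have := near_bd z1 Bz1 (Or32 _ _ H); lra.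
have in3 : tb + eta < z1.2.
  by rewrite ltNge; apply/negP => H; have := near_bd z1 Bz1 (Or33 _ _ H); lra.
have [|v vh v0] := Hv.
  case: (z1) Bz1 in1 in2 in3 wz1 => x t Bz1 /= in1 in2 in3 wz1.
  have [/= b1 b2] := Bz1.
  move=> [x' t'] [/= c1 c2].
  have d1 : `|x - x'| <= rho by rewrite ger0_norm; lra.
  have d2 : `|t - t'| <= rho by rewrite ger0_norm; lra.
  by have /ltr_normlW := Hrho (x, t) (x', t') Bz1 d1 d2; lra.
have : r * F z1 <= v.
  apply: (heat_at_max (a := xl + eta) (b := xr - eta) (t0 := tb + eta) vh).
  - by apply/andP; split.
  - by [].
  - move=> x xI; apply: Fmax; apply/mem_set; case: Dz1 => d1 d2.
    by split => //=; lra.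
  - move=> t tI; apply: Fmax; apply/mem_set; case: Dz1 => d1 d2.
    by split => //=; lra.
have : 0 < r * F z1 by rewrite mulr_gt0//; lra.
lra.
Qed.

(** * Smooth functions *)

(** Grading by the order makes closure under sums, products and affine substitution a plain
    induction: the product rule at order [n.+1] uses factors of order [n]. *)
Fixpoint Cn {R : realType} (n : nat) (f : R -> R) : Prop :=
  if n is m.+1 then (forall x, derivable f x 1) /\ Cn m (derive1 f) else True.

Definition Cinf {R : realType} (f : R -> R) : Prop := forall n, Cn n f.

Lemma CnP (R : realType) n (f g : R -> R) :
  (forall x, is_derive x (1 : R) f (g x)) -> Cn n g -> Cn n.+1 f.
Proof.
move=> fg Cg; split; first by move=> x; have [] := fg x.
by rewrite (_ : (derive1 f) = g)//; apply/funext => x; rewrite derive1E; have [_] := fg x.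
Qed.

Lemma CnW (R : realType) n (f : R -> R) : Cn n.+1 f -> Cn n f.
Proof. by elim: n f => [//|n IH] f [df /IH]; split. Qed.

Lemma Cn_is_derive (R : realType) n (f : R -> R) : Cn n.+1 f ->
  forall x, is_derive x (1 : R) f ((derive1 f) x).
Proof. by move=> [df _] x; apply: DeriveDef => //; rewrite derive1E. Qed.

Lemma CnD (R : realType) n (f g : R -> R) : Cn n f -> Cn n g ->
  Cn n (fun x => f x + g x).
Proof.
elim: n f g => [//|n IH] f g Cf Cg.
apply: (@CnP _ _ _ (fun x => (derive1 f) x + (derive1 g) x)).
  by move=> x; exact: (is_deriveD (Cn_is_derive Cf x) (Cn_is_derive Cg x)).
by apply: IH; [case: Cf|case: Cg].
Qed.

Lemma CnM (R : realType) n (f g : R -> R) : Cn n f -> Cn n g ->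
  Cn n (fun x => f x * g x).
Proof.
elim: n f g => [//|n IH] f g Cf Cg.
apply: (@CnP _ _ _ (fun x => f x * (derive1 g) x + g x * (derive1 f) x)).
  by move=> x; exact: (is_deriveM (Cn_is_derive Cf x) (Cn_is_derive Cg x)).
by apply: CnD; apply: IH; [exact: CnW|case: Cg|exact: CnW|case: Cf].
Qed.

Lemma Cn_cst (R : realType) n (c : R) : Cn n (fun=> c).
Proof.
elim: n c => [//|n IH] c.
by apply: (@CnP _ _ _ (fun=> 0)) => // x; exact: is_derive_cst.
Qed.

Lemma is_derive_affine (R : realType) (f : R -> R) (a b d x : R) :
  is_derive (a * x + b) (1 : R) f d -> is_derive x (1 : R) (fun x => f (a * x + b)) (a * d).
Proof.
move=> df.
have dg : is_derive x (1 : R) (fun x => a * x + b) a.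
  have := is_deriveD (is_deriveZ a (is_derive_id x (1 : R))) (is_derive_cst b x 1).
  by rewrite addr0 [a *: _]mulr1.
by rewrite mulrC; exact: (@is_derive1_comp _ f (fun x => a * x + b) x d a df dg).
Qed.

Lemma Cn_affine (R : realType) n (f : R -> R) (a b : R) : Cn n f ->
  Cn n (fun x => f (a * x + b)).
Proof.
elim: n f => [//|n IH] f Cf.
apply: (@CnP _ _ _ (fun x => a * (derive1 f) (a * x + b))).
  by move=> x; apply: is_derive_affine; exact: (Cn_is_derive Cf).
by apply: CnM; [exact: Cn_cst|apply: IH; case: Cf].
Qed.

Lemma Cinf_derive (R : realType) (f : R -> R) : Cinf f ->
  Cinf (derive1 f) /\ forall x, is_derive x (1 : R) f ((derive1 f) x).
Proof.
move=> Cf; split; first by move=> n; have [] := Cf n.+1.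
exact: (Cn_is_derive (Cf 1)).
Qed.

Lemma Cinf_continuous (R : realType) (f : R -> R) : Cinf f -> continuous f.
Proof.
move=> /Cinf_derive[_ df] x; apply/differentiable_continuous/derivable1_diffP.
by have [] := df x.
Qed.

(** * A bump function *)

(* Indexed by [k] so that the linear span is closed under differentiation. *)
Definition flat {R : realType} (k : nat) (x : R) : R :=
  if 0 < x then x^-1 ^+ k * expR (- x^-1) else 0.

(** The exponential of [x^-1] is at least its Taylor term of order [k.+1], one power more than the
    factor it has to beat. *)
Lemma flat_bound (R : realType) k (x : R) : 0 < x ->
  flat k x <= k.+1`!%:R * x.
Proof.
move=> x0; rewrite /flat x0.
have y0 : 0 < x^-1 by rewrite invr_gt0.
have : x^-1 ^+ k.+1 / k.+1`!%:R <= expR x^-1.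
  by apply: le_trans (expR_ge1Dxn k (ltW y0)); rewrite lerDr.
rewrite ler_pdivrMr ?ltr0n ?fact_gt0// => H.
rewrite expRN ler_pdivrMr ?expR_gt0//.
have -> : x^-1 ^+ k = x^-1 ^+ k.+1 * x by rewrite exprSr mulfVK// gt_eqF.
by rewrite mulrAC ler_pM2r// mulrC.
Qed.

Lemma is_derive_flat (R : realType) k (x : R) :
  is_derive x (1 : R) (flat k) (flat k.+2 x - k%:R * flat k.+1 x).
Proof.
have [x0|x0|->] := ltgtP x 0.
- rewrite /flat (lt_gtF x0) mulr0 subr0.
  have nE : \forall y \near x, cst 0 y = flat k y.
    by near=> y; rewrite /flat ifF//; apply/lt_gtF; near: y; exact: lt_nbhsl.
  exact: near_eq_is_derive nE (is_derive_cst _ _ _).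
- have xn0 : x != 0 by rewrite gt_eqF.
  have nE : \forall y \near x, (y^-1) ^+ k * expR (- y^-1) = flat k y.
    by near=> y; rewrite /flat ifT//; near: y; exact: lt_nbhsr.
  apply: (near_eq_is_derive nE).
  have dV : is_derive x (1 : R) (fun y => y^-1) (- x ^- 2).
    have := @is_deriveV _ id x 1 1 xn0 (is_derive_id x (1 : R)).
    by rewrite [_ *: _]mulr1.
  have dX := is_deriveX k dV.
  have dN := is_deriveN dV.
  have dE := @is_derive1_comp _ expR _ x _ _ (is_derive_expR (- x^-1)) dN.
  rewrite (_ : (fun y => _) =
      (fun y => y^-1) ^+ k * (expR \o - (fun y => y^-1))); last first.
    by apply/funext => y; rewrite !fctE.
  apply: (is_derive_eq (is_deriveM dX dE)).
  rewrite /flat x0 /GRing.scale/= !fctE.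
  have -> : k%:R * x^-1 ^+ k.-1 * (- x ^- 2) = - (k%:R * x^-1 ^+ k.+1).
    case: (k) => [|j]; first by rewrite !mul0r oppr0.
    by rewrite -exprVn/= !exprS; ring.
  by rewrite -exprVn opprK !exprS; ring.
- rewrite /flat ltxx mulr0 subr0.
  suff H : h^-1 *: ((flat k \o shift 0) (h *: (1 : R)) - flat k 0) @[h --> 0^'] --> (0 : R).
    by apply: DeriveDef; [apply/cvg_ex; exists 0|exact/cvg_lim].
  apply/cvgrPdist_le => e e0; rewrite /dnbhs near_withinE.
  have e'0 : 0 < e / k.+2`!%:R by rewrite divr_gt0// ltr0n fact_gt0.
  near=> h => h0.
  rewrite sub0r normrN /= addr0 [h *: 1]mulr1 {2}/flat ltxx subr0 /flat.
  case: ifPn => hp; last by rewrite scaler0 normr0 ltW.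
  (* At [0] the difference quotient of [flat k] is [flat k.+1], which [flat_bound] makes small. *)
  have -> : h^-1 *: (h^-1 ^+ k * expR (- h^-1)) = flat k.+1 h.
    by rewrite /flat hp exprS /GRing.scale/= mulrA.
  rewrite ger0_norm; last first.
    by rewrite /flat hp mulr_ge0 ?expR_ge0 ?exprn_ge0 ?invr_ge0// ltW.
  apply: le_trans (flat_bound _ hp) _.
  rewrite mulrC -ler_pdivlMr ?ltr0n ?fact_gt0// ltW//.
  by near: h; exact: lt_nbhsl.
Unshelve. all: by end_near. Qed.

Lemma Cinf_flat (R : realType) k : Cinf (@flat R k).
Proof.
move=> n; elim: n k => [//|n IH] k.
apply: CnP (is_derive_flat k) _.
apply: CnD => //.
rewrite (_ : (fun x => - (k%:R * flat k.+1 x)) = (fun x => - k%:R * flat k.+1 x)).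
  by apply: CnM => //; exact: Cn_cst.
by apply/funext => x; rewrite mulNr.
Qed.

Lemma flat_ge0 (R : realType) k (x : R) : 0 <= flat k x.
Proof.
rewrite /flat; case: ifP => // x0.
by rewrite mulr_ge0 ?expR_ge0 ?exprn_ge0 ?invr_ge0// ltW.
Qed.

(* Supported strictly below [0], so that mollifying with it only uses values
   of a function at earlier times and still makes sense at the final time. *)
Definition bump {R : realType} (e x : R) : R :=
  flat 0 (e^-1 * x + 2) * flat 0 (- e^-1 * x - 1).

Lemma Cinf_bump (R : realType) (e : R) : Cinf (bump e).
Proof. by move=> n; apply: CnM; apply: Cn_affine; exact: Cinf_flat. Qed.

Lemma bump_ge0 (R : realType) (e x : R) : 0 <= bump e x.
Proof. by rewrite mulr_ge0// flat_ge0. Qed.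

Lemma bump_supp (R : realType) (e x : R) : 0 < e -> bump e x != 0 ->
  - (2 * e) < x < - e.
Proof.
move=> e0; rewrite /bump /flat; case: ifPn => [h1|]; last by rewrite mul0r eqxx.
case: ifPn => [h2|]; last by rewrite mulr0 eqxx.
move=> _.
have ex : e * (e^-1 * x) = x by rewrite mulrA mulfV ?gt_eqF// mul1r.
have := mulr_gt0 e0 h1; have := mulr_gt0 e0 h2.
rewrite mulNr mulrBr mulrDr mulrN ex; lra.
Qed.

Lemma bump_gt0 (R : realType) (e : R) : 0 < e -> 0 < bump e (- (3 / 2 * e)).
Proof.
move=> e0; rewrite /bump /flat.
have -> : e^-1 * - (3 / 2 * e) + 2 = 1 / 2 by field; rewrite gt_eqF.
have -> : - e^-1 * - (3 / 2 * e) - 1 = 1 / 2 by field; rewrite gt_eqF.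
have -> : (0 : R) < 1 / 2 by lra.
by rewrite !expr0 !mul1r mulr_gt0// expR_gt0.
Qed.

(** * Smooth functions of one and two variables *)

(** [smooth] quantifies over all iterated directional derivatives, so a class stable under every
    ['D_v] is needed. Linear combinations of products of two smooth profiles of linear forms are
    stable, and they contain the product kernels. *)
Inductive ridge {R : realType} {V : normedModType R} : (V -> R) -> Prop :=
| ridge_prod (l1 l2 : {linear V -> R}) a b : continuous l1 -> continuous l2 ->
    Cinf a -> Cinf b -> ridge (fun z => a (l1 z) * b (l2 z))
| ridge_comb c f g : ridge f -> ridge g -> ridge (fun z => c * f z + g z).

Lemma is_derive_comp_linear (R : realType) (V : normedModType R)
    (l : {linear V -> R}) (a : R -> R) (z v : V) (d : R) :
  continuous l -> is_derive (l z) (1 : R) a d ->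
  differentiable (fun z => a (l z)) z /\
  is_derive z v (fun z => a (l z)) (l v * d).
Proof.
move=> cl [/derivable1_diffP dda <-].
have dl := linear_differentiable z cl.
have dc : differentiable (a \o l) z by exact: differentiable_comp.
split => //; apply: DeriveDef; first exact: diff_derivable.
rewrite deriveE// (diff_comp dl dda)/= diff_lin// deriveE//.
have <- : 'd a (l z) (l v *: (1 : R)) = l v * 'd a (l z) 1 by rewrite linearZ.
by rewrite [_ *: _]mulr1.
Qed.

Lemma ridge_derive (R : realType) (V : normedModType R) (f : V -> R) : ridge f ->
  (forall z, differentiable f z) /\ forall v, ridge ('D_v f).
Proof.
elim => [l1 l2 a b c1 c2 Ca Cb|c {}f g _ [df Df] _ [dg Dg]].
  have [[Ca' da] [Cb' db]] := (Cinf_derive Ca, Cinf_derive Cb).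
  split => [z|v].
    apply: differentiableM.
      by have [] := is_derive_comp_linear 0 c1 (da (l1 z)).
    by have [] := is_derive_comp_linear 0 c2 (db (l2 z)).
  (* [ridge_comb] always wants a last summand, so the derivative is closed off with a zero written
     as a product. *)
  rewrite (_ : 'D_v _ = fun z => l1 v * ((derive1 a) (l1 z) * b (l2 z)) +
     (l2 v * (a (l1 z) * (derive1 b) (l2 z)) + a (l1 z) * 0)); last first.
    apply/funext => z.
    have [_ d1] := is_derive_comp_linear v c1 (da (l1 z)).
    have [_ d2] := is_derive_comp_linear v c2 (db (l2 z)).
    have [_ ->] := is_deriveM d1 d2.
    by rewrite /GRing.scale/=; ring.
  apply: ridge_comb; first exact: ridge_prod.
  apply: ridge_comb; first exact: ridge_prod.
  apply: (@ridge_prod _ _ l1 l2 a (fun=> 0)) => //.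
  by move=> n; exact: Cn_cst.
split => [z|v].
  apply: differentiableD => //.
  by apply: differentiableM => //; exact: differentiable_cst.
rewrite (_ : 'D_v _ = fun z => c * 'D_v f z + 'D_v g z).
  exact: ridge_comb.
apply/funext => z.
have d1 : is_derive z v f ('D_v f z) by exact/derivableP/diff_derivable.
have d2 : is_derive z v g ('D_v g z) by exact/derivableP/diff_derivable.
by have [_ ->] := is_deriveD (is_deriveZ c d1) d2.
Qed.

Lemma ridge_smooth (R : realType) (V : normedModType R) (f : V -> R) :
  ridge f -> smooth f.
Proof.
move=> rf vs; suff : ridge (foldr (fun v (f : V -> R) => 'D_v f) f vs).
  by move=> /ridge_derive[].
by elim: vs => [//|v vs IH] /=; have [] := ridge_derive IH.
Qed.

(** * Mollification *)

Definition supported {R : realType} (a b : R) (f : R -> R) : Prop :=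
  Cinf f /\ forall x, ~ (a <= x <= b) -> f x = 0.

Lemma supported_derive (R : realType) (a b : R) (f : R -> R) :
  supported a b f -> supported a b (derive1 f).
Proof.
move=> [Cf f0]; have [Cf' df] := Cinf_derive Cf; split => // x xab.
have nE : \forall y \near x, cst 0 y = f y.
  have : (x < a) \/ (b < x).
    by have [|ax] := ltP x a; [left|right; rewrite ltNge; apply/negP => xb; apply: xab; rewrite ax].
  case=> H; near=> y; rewrite /= f0// => /andP[ay yb].
    suff : y < a by rewrite ltNge ay.
    by near: y; exact: lt_nbhsl.
  suff : b < y by rewrite ltNge yb.
  by near: y; exact: lt_nbhsr.
have [_ <-] := near_eq_is_derive nE (is_derive_cst (0 : R) x (1 : R)).
by rewrite derive1E.
Unshelve. all: end_near. Qed.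

Lemma supported_bounded (R : realType) (a b : R) (f : R -> R) :
  supported a b f -> exists2 M, 0 <= M & forall x, `|f x| <= M.
Proof.
move=> [Cf f0].
have [ab|ba] := leP a b; last first.
  exists 0 => // x; rewrite f0 ?normr0// => /andP[ax xb].
  by have := le_lt_trans (le_trans ax xb) ba; rewrite ltxx.
have cf : {within `[a, b], continuous (fun x => `|f x|)}.
  apply: continuous_subspaceT => x; apply: (@continuous_comp _ _ _ f Num.norm).
    exact: (Cinf_continuous Cf).
  exact: norm_continuous.
have [c _ cmax] := EVT_max ab cf.
exists `|f c| => // x.
have [xab|/negP xab] := boolP (a <= x <= b); first exact: cmax.
by rewrite f0// normr0.
Qed.

Lemma supported_measurable (R : realType) (a b : R) (f : R -> R) :
  supported a b f -> measurable_fun setT f.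
Proof. by move=> [/Cinf_continuous cf _]; exact: continuous_measurable_fun. Qed.

Lemma supported_is_derive (R : realType) (a b : R) (f : R -> R) :
  supported a b f -> forall x, is_derive x (1 : R) f (derive1 f x).
Proof. by move=> [/Cinf_derive[_ df] _]. Qed.

(** * Integrability and differentiation under the integral sign *)

Section integrals.
Context d (X : measurableType d) (R : realType) (mu : {measure set X -> \bar R}).

Definition intg (f : X -> R) : Prop := mu.-integrable setT (EFin \o f).

Lemma intg_mul (f h : X -> R) M : intg f -> measurable_fun setT h ->
  (forall z, `|h z| <= M) -> intg (fun z => f z * h z).
Proof.
move=> fi mh hM; apply: (@integrableMl _ _ _ _ _ measurableT (EFin \o f) h) => //.
by exists M; split; [exact: num_real|move=> N /ltW MN z _; exact: le_trans (hM z) MN].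
Qed.

Lemma intgD (f g : X -> R) : intg f -> intg g -> intg (fun z => f z + g z).
Proof. by move=> fi gi; exact: (integrableD measurableT fi gi). Qed.

Lemma intgZ (c : R) (f : X -> R) : intg f -> intg (fun z => c * f z).
Proof. by move=> fi; exact: (integrableZl measurableT c fi). Qed.

(** Dominated differentiation: the derivative of the integrand is bounded by [|m|] times the
    supremum of [|derive1 f|]. The map [p] lets one statement serve the space coordinate, the time
    coordinate and the one-dimensional case. *)
Lemma is_derive_convolution (a b : R) (m p : X -> R) (f : R -> R) :
  intg m -> measurable_fun setT p -> supported a b f ->
  forall x : R, is_derive x (1 : R) (fun x => \int[mu]_z (m z * f (p z - x)))
    (- \int[mu]_z (m z * derive1 f (p z - x))).
Proof.
move=> mi mp sf x.
have sf' := supported_derive sf.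
have [M M0 fM] := supported_bounded sf.
have [M' M'0 fM'] := supported_bounded sf'.
have mh g : supported a b g -> forall y, measurable_fun setT (fun z => g (p z - y)).
  move=> /supported_measurable mg y; apply: (measurableT_comp mg).
  exact: measurable_funB.
pose F y z := m z * f (p z - y).
have dF z y : is_derive y (1 : R) (F ^~ z) (- (m z * derive1 f (p z - y))).
  have d1 : is_derive (-1 * y + p z) (1 : R) f (derive1 f (-1 * y + p z)).
    exact: (supported_is_derive sf).
  have d2 := is_deriveZ (m z) (is_derive_affine d1).
  have e1 : -1 * y + p z = p z - y by ring.
  rewrite (_ : F ^~ z = m z \*: (fun y => f (-1 * y + p z))).
    by apply: (is_derive_eq d2); rewrite e1 /GRing.scale/=; ring.
  by apply/funext => t; rewrite /F /GRing.scale/=; congr (_ * f _); ring.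
have dE y z : partial1of2 F y z = - (m z * derive1 f (p z - y)).
  by rewrite partial1of2E; have [_ ->] := dF z y.
have Ia : `]x - 1, x + 1[%classic x.
  by rewrite /= in_itv/= ltrBlDr ltrDl ltr01.
have iF y : intg (F y) by apply: (intg_mul mi (mh _ sf y)) => z; exact: fM.
have dFd y z : `]x - 1, x + 1[%classic y -> setT z -> derivable (F ^~ z) y 1.
  by move=> _ _; have [] := dF z y.
have G0 z : 0 <= `|m z| * M' by rewrite mulr_ge0.
have iG : intg (fun z => `|m z| * M').
  apply: (@intg_mul (fun z => `|m z|) (cst M') `|M'|) => //.
  exact: (integrable_abse mi).
have GB y z : `]x - 1, x + 1[%classic y -> setT z -> `|partial1of2 F y z| <= `|m z| * M'.
  by move=> _ _; rewrite dE normrN normrM ler_wpM2l.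
have H1 := @derivable_under_integral _ _ _ mu F setT measurableT x _ _ Ia
  (fun y _ => iF y) dFd _ G0 iG GB.
have H2 := @differentiation_under_integral _ _ _ mu F setT measurableT x _ _ Ia
  (fun y _ => iF y) dFd _ G0 iG GB.
apply: DeriveDef => //; rewrite -derive1E H2.
rewrite -mulN1r -RintegralZl//.
  by apply: eq_Rintegral => z _; rewrite dE mulN1r.
by apply: (intg_mul mi (mh _ sf' x)) => z; exact: fM'.
Qed.

End integrals.

(** * Normalised kernels on the line *)

Section mollifier.
Context {R : realType}.
Notation leb := (@lebesgue_measure R).

Lemma supported_intg (a b : R) (f : R -> R) : supported a b f -> intg leb f.
Proof.
move=> [Cf f0].
have i1 : leb.-integrable `[a, b] (EFin \o f).
  apply: continuous_compact_integrable; first exact: segment_compact.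
  by apply: continuous_subspaceT => x; exact: (Cinf_continuous Cf).
rewrite /intg (_ : EFin \o f = (EFin \o f) \_ `[a, b]).
  by apply/(integrable_restrict leb _ measurableT (EFin \o f)) => //; rewrite setTI.
apply/funext => x; rewrite restrict_EFin /= patchE.
case: ifPn => // /negP xab; rewrite f0// => H; apply: xab.
by apply/mem_set; rewrite /= in_itv.
Qed.

Lemma integral_translation (f : R -> R) (x : R) : continuous f ->
  (forall y, 0 <= f y) ->
  (\int[leb]_y (f (y - x))%:E = \int[leb]_y (f y)%:E)%E.
Proof.
move=> cf f0.
pose F : R -> R := fun y => y + - x.
have dF y : is_derive y (1 : R) F 1.
  by have := is_deriveD (is_derive_id y (1 : R)) (is_derive_cst (- x) y 1); rewrite addr0.
have F' : (derive1 F) = cst 1.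
  by apply/funext => y; rewrite derive1E; have [_ ->] := dF y.
rewrite (@increasing_ge0_integration_by_substitutionT _ F f) ?F'//.
- by apply: eq_integral => y _; rewrite fctE /= mulr1.
- by move=> y z yz; rewrite /F ltrD2r.
- by move=> y; exact: cst_continuous.
- exact: is_cvg_cst.
- exact: is_cvg_cst.
- exact: cvg_addrr_Ny.
- exact: cvg_addrr.
Qed.

Lemma bump_supported (e : R) : 0 < e -> supported (- (2 * e)) (- e) (bump e).
Proof.
move=> e0; split; first exact: Cinf_bump.
move=> x; have [//|/(bump_supp e0) /andP[/ltW h1 /ltW h2] []] := eqVneq (bump e x) 0.
by rewrite h1.
Qed.

Lemma bump_integral_gt0 (e : R) : 0 < e -> (0 < \int[leb]_y (bump e y)%:E)%E.
Proof.
move=> e0; set c := - (3 / 2 * e).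
have b0 : 0 < bump e c by exact: bump_gt0.
have cb := Cinf_continuous (@Cinf_bump _ e).
have mb : measurable_fun setT (bump e) by exact: continuous_measurable_fun.
have b20 : 0 < bump e c / 2 by rewrite divr_gt0.
have /cvgrPdist_lt/(_ _ b20)/nbhs_ballP[del /= del0 H] := cb c.
pose I : set R := `]c - del, c + del[%classic.
have i1 : measurable I by exact: measurable_itv.
have h1 : (0 < \int[leb]_(x in I) (cst (bump e c / 2)%R%:E x))%E.
  rewrite integral_cst//= lebesgue_measure_itv/= lte_fin ltrBlDr -addrA ltrDl addr_gt0//.
  by rewrite -EFinD -EFinM lte_fin mulr_gt0//; lra.
apply: (lt_le_trans h1).
apply: (@le_trans _ _ (\int[leb]_(x in I) (bump e x)%:E)%E).
  apply: ge0_le_integral => //.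
  - by move=> x _; rewrite lee_fin ltW.
  - by apply/measurable_EFinP; exact: measurable_funS mb.
  - move=> x; rewrite /I/= in_itv/= => xI; rewrite lee_fin.
    have : ball c del x by rewrite /ball/= ltr_norml; lra.
    by move=> /H/ltr_normlW; lra.
apply: ge0_subset_integral => //; first exact/measurable_EFinP.
by move=> x _; rewrite lee_fin bump_ge0.
Qed.

Lemma mollifierP (e : R) : 0 < e -> exists k : R -> R,
  [/\ supported (- (2 * e)) (- e) k, forall x, 0 <= k x &
      forall x, (\int[leb]_y (k (y - x))%:E = 1)%E].
Proof.
move=> e0.
have sb := bump_supported e0.
have ib := supported_intg sb.
set N := (\int[leb]_y (bump e y)%:E)%E.
have N0 : (0 < N)%E by exact: bump_integral_gt0.
have Nf : N = (fine N)%:E by rewrite fineK//; exact: (integrable_fin_num measurableT ib).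
have n0 : 0 < fine N by rewrite -lte_fin -Nf.
exists (fun x => (fine N)^-1 * bump e x).
have s1 : supported (- (2 * e)) (- e) (fun x => (fine N)^-1 * bump e x).
  split; last by move=> x xe; case: sb => _ ->//; rewrite mulr0.
  by move=> n; apply: CnM; [exact: Cn_cst|exact: Cinf_bump].
have k0 x : 0 <= (fine N)^-1 * bump e x by rewrite mulr_ge0 ?bump_ge0// invr_ge0 ltW.
split => // x.
rewrite (@integral_translation (fun x => (fine N)^-1 * bump e x))//; last first.
  by apply: Cinf_continuous; case: s1.
under eq_integral do rewrite EFinM.
rewrite (integralZl measurableT ib) -/N Nf -EFinM mulVf// gt_eqF//.
Qed.

Lemma measurable_shift1 (f : R -> R) (x : R) : measurable_fun setT f ->
  measurable_fun setT (fun y : measurableTypeR R * measurableTypeR R => f (y.1 - x)).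
Proof.
move=> mf; apply: (@measurableT_comp _ _ _ _ _ _ f _
  (fun y : measurableTypeR R * measurableTypeR R => y.1 - x)) => //.
exact: measurable_funB.
Qed.

Lemma measurable_shift2 (f : R -> R) (x : R) : measurable_fun setT f ->
  measurable_fun setT (fun y : measurableTypeR R * measurableTypeR R => f (y.2 - x)).
Proof.
move=> mf; apply: (@measurableT_comp _ _ _ _ _ _ f _
  (fun y : measurableTypeR R * measurableTypeR R => y.2 - x)) => //.
exact: measurable_funB.
Qed.

End mollifier.

Lemma average_close d (X : measurableType d) (R : realType)
    (mu : {measure set X -> \bar R}) (u f : X -> R) (c eta : R) :
  intg mu (fun y => u y * f y) -> measurable_fun setT f -> (forall y, 0 <= f y) ->
  (\int[mu]_y (f y)%:E = 1)%E -> (forall y, f y != 0 -> `|u y - c| <= eta) ->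
  `|(\int[mu]_y (u y * f y)) - c| <= eta.
Proof.
move=> iuf mf f0 f1 uc.
have if_ : intg mu f.
  apply/integrableP; split; first exact/measurable_EFinP.
  under eq_integral => y _.
    rewrite /= ger0_norm; last by [].
    over.
  by rewrite f1 ltry.
have f1' : \int[mu]_y (f y) = 1 by rewrite /Rintegral f1.
rewrite ler_distl; apply/andP; split.
  rewrite -[leLHS]mulr1 -f1' -RintegralZl//.
  apply: le_Rintegral => //; first exact: intgZ.
  move=> y _; have [->|/uc] := eqVneq (f y) 0; first by rewrite !mulr0.
  by rewrite ler_distl => /andP[h _]; rewrite ler_wpM2r.
rewrite -[leRHS]mulr1 -f1' -RintegralZl//.
apply: le_Rintegral => //; first exact: intgZ.
move=> y _; have [->|/uc] := eqVneq (f y) 0; first by rewrite !mulr0.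
by rewrite ler_distl => /andP[_ h]; rewrite ler_wpM2r.
Qed.

(** * Mollification in space-time *)

Section mollification.
Context {R : realType}.
Notation leb := (@lebesgue_measure R).
Notation leb2 := (@lebesgue2 R).

(** With the kernel evaluated at [y - z], support on the negative axis means that earlier times are
    sampled, and each derivative in [z] costs a sign. The product form lets a derivative fall on a
    single factor. *)
Definition moll (u : R * R -> R) (k : R -> R) (z : R * R) : R :=
  \int[leb2]_y (u y * (k (y.1 - z.1) * k (y.2 - z.2))).

Lemma measurable_product (a b a' b' : R) (f g : R -> R) (x t : R) :
  supported a b f -> supported a' b' g ->
  measurable_fun setT (fun y : measurableTypeR R * measurableTypeR R =>
    f (y.1 - x) * g (y.2 - t)).
Proof.
move=> /supported_measurable mf /supported_measurable mg.
exact: (measurable_funM (measurable_shift1 x mf) (measurable_shift2 t mg)).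
Qed.

Lemma intg_product (a b a' b' : R) (u : R * R -> R) (f g : R -> R) (x t : R) :
  intg leb2 u -> supported a b f -> supported a' b' g ->
  intg leb2 (fun y => u y * (f (y.1 - x) * g (y.2 - t))).
Proof.
move=> iu sf sg.
have [M M0 fM] := supported_bounded sf.
have [N N0 gN] := supported_bounded sg.
apply: (@intg_mul _ _ _ _ _ _ (M * N)) => //.
  exact: (measurable_product _ _ sf sg).
by move=> z; rewrite normrM ler_pM.
Qed.

Lemma is_derive_moll_x (a b a' b' : R) (u : R * R -> R) (f g : R -> R) (x t : R) :
  intg leb2 u -> supported a b f -> supported a' b' g ->
  is_derive x (1 : R) (fun x => \int[leb2]_y (u y * (f (y.1 - x) * g (y.2 - t))))
    (- \int[leb2]_y (u y * (derive1 f (y.1 - x) * g (y.2 - t)))).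
Proof.
move=> iu sf sg.
have [N N0 gN] := supported_bounded sg.
have im : intg leb2 (fun y => u y * g (y.2 - t)).
  apply: (@intg_mul _ _ _ _ _ _ N) => //.
  exact: measurable_shift2 (supported_measurable sg).
rewrite (_ : (fun x => _) = (fun x =>
    \int[leb2]_y (u y * g (y.2 - t) * f (y.1 - x)))); last first.
  by apply/funext => s; apply: eq_Rintegral => y _; rewrite -!mulrA; congr (_ * _); rewrite mulrC.
apply: (is_derive_eq (is_derive_convolution im measurable_fst sf x)); congr (- _).
by apply: eq_Rintegral => y _; rewrite -!mulrA; congr (_ * _); rewrite mulrC.
Qed.

Lemma is_derive_moll_t (a b a' b' : R) (u : R * R -> R) (f g : R -> R) (x t : R) :
  intg leb2 u -> supported a b f -> supported a' b' g ->
  is_derive t (1 : R) (fun t => \int[leb2]_y (u y * (f (y.1 - x) * g (y.2 - t))))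
    (- \int[leb2]_y (u y * (f (y.1 - x) * derive1 g (y.2 - t)))).
Proof.
move=> iu sf sg.
have [N N0 fN] := supported_bounded sf.
have im : intg leb2 (fun y => u y * f (y.1 - x)).
  apply: (@intg_mul _ _ _ _ _ _ N) => //.
  exact: measurable_shift1 (supported_measurable sf).
rewrite (_ : (fun t => _) = (fun t =>
    \int[leb2]_y (u y * f (y.1 - x) * g (y.2 - t)))); last first.
  by apply/funext => s; apply: eq_Rintegral => y _; rewrite -!mulrA.
apply: (is_derive_eq (is_derive_convolution im measurable_snd sg t)); congr (- _).
by apply: eq_Rintegral => y _; rewrite -!mulrA.
Qed.

Lemma bounded_derive_lipschitz (f df : R -> R) (C : R) :
  (forall x, is_derive x (1 : R) f (df x)) -> (forall x, `|df x| <= C) ->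
  forall x y, `|f x - f y| <= C * `|x - y|.
Proof.
move=> dfx dfC.
have H x y : x <= y -> `|f y - f x| <= C * `|y - x|.
  move=> xy.
  have [|c _ ->] := MVT_segment xy (fun z _ => dfx z).
    by apply: derivable_within_continuous => z _; have [] := dfx z.
  by rewrite normrM ler_wpM2r.
move=> x y; have [/H|/ltW/H//] := leP x y.
by rewrite distrC [`|y - x|]distrC.
Qed.

(** Both partial derivatives are bounded by the same constant [C], so the mollification is Lipschitz
    in each variable separately, hence jointly continuous. *)
Lemma moll_continuous (a b : R) (u : R * R -> R) (k : R -> R) :
  intg leb2 u -> supported a b k -> continuous (moll u k).
Proof.
move=> iu sk.
have sk' := supported_derive sk.
have [M M0 kM] := supported_bounded sk.
have [N N0 kN] := supported_bounded sk'.
pose C := \int[leb2]_y (`|u y| * (M * N)).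
have iC : intg leb2 (fun y => `|u y| * (M * N)).
  have iau : intg leb2 (fun y => `|u y|) by exact: (integrable_abse iu).
  exact: (intg_mul iau (measurable_cst (M * N)) (fun=> lexx `|M * N|)).
have C0 : 0 <= C by apply: Rintegral_ge0 => y _; rewrite !mulr_ge0.
have bnd (f g : R -> R) x t : supported a b f -> supported a b g ->
    (forall s s', `|f s * g s'| <= M * N) ->
    `|- \int[leb2]_y (u y * (f (y.1 - x) * g (y.2 - t)))| <= C.
  move=> sf sg fgC; rewrite normrN.
  have ifg := intg_product x t iu sf sg.
  apply: le_trans (le_normr_Rintegral measurableT ifg) _.
  apply: le_Rintegral => //; first exact: (integrable_abse ifg).
  by move=> y _; rewrite normrM ler_wpM2l.
have Lx x x' t : `|moll u k (x, t) - moll u k (x', t)| <= C * `|x - x'|.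
  apply: (bounded_derive_lipschitz (fun x => is_derive_moll_x x t iu sk sk)).
  by move=> s; apply: bnd => // ? ?; rewrite normrM mulrC ler_pM.
have Lt x t t' : `|moll u k (x, t) - moll u k (x, t')| <= C * `|t - t'|.
  apply: (bounded_derive_lipschitz (fun t => is_derive_moll_t x t iu sk sk)).
  by move=> s; apply: bnd => // ? ?; rewrite normrM ler_pM.
move=> z; apply/cvgrPdist_lt => e e0.
have d0 : 0 < e / (2 * (C + 1)) by rewrite divr_gt0// mulr_gt0//; lra.
apply: filterS (nbhsx_ballx z _ d0).
move=> z' [/= bx bt]; rewrite /ball/= in bx bt.
case: z z' bx bt => [x t] [x' t'] /= bx bt.
have -> : moll u k (x, t) - moll u k (x', t') =
  (moll u k (x, t) - moll u k (x', t)) + (moll u k (x', t) - moll u k (x', t')) by ring.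
apply: le_lt_trans (ler_normD _ _) _.
have H (s : R) : `|s| < e / (2 * (C + 1)) -> C * `|s| < e / 2.
  move=> hs; have hC : 0 < C + 1 by lra.
  have : (C + 1) * `|s| < e / 2.
    rewrite mulrC -ltr_pdivlMr//; apply: lt_le_trans hs _.
    by rewrite invfM mulrA.
  by have := normr_ge0 s; rewrite mulrDl mul1r; lra.
have := Lx x x' t; have := Lt x' t t'.
have := H (x - x') bx; have := H (t - t') bt; lra.
Qed.

Lemma moll_mass (k : R -> R) (a b : R) (z : R * R) : supported a b k ->
  (forall x, 0 <= k x) -> (forall x, (\int[leb]_y (k (y - x))%:E = 1)%E) ->
  (\int[leb2]_y (k (y.1 - z.1) * k (y.2 - z.2))%:E = 1)%E.
Proof.
move=> sk k0 k1.
rewrite /lebesgue2 fubini_tonelli1//=; last 2 first.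
- by apply/measurable_EFinP; exact: (measurable_product _ _ sk sk).
- by move=> y; rewrite lee_fin mulr_ge0.
rewrite /fubini_F.
transitivity (\int[leb]_x (k (x - z.1))%:E)%E => //.
apply: eq_integral => x _ /=.
under eq_integral do rewrite EFinM.
rewrite ge0_integralZl//.
- by rewrite k1 mule1.
- apply/measurable_EFinP; apply: (measurableT_comp (supported_measurable sk)).
  exact: measurable_funB.
- by move=> y _; rewrite lee_fin.
- by rewrite lee_fin.
Qed.

Lemma moll_close (e c eta : R) (u : R * R -> R) (k : R -> R) (z : R * R) :
  intg leb2 u -> supported (- (2 * e)) (- e) k ->
  (forall x, 0 <= k x) -> (forall x, (\int[leb]_y (k (y - x))%:E = 1)%E) ->
  (forall y, box (z.1 - 2 * e) (z.1 - e) (z.2 - 2 * e) (z.2 - e) y ->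
     `|u y - c| <= eta) ->
  `|moll u k z - c| <= eta.
Proof.
move=> iu sk k0 k1 uc.
apply: average_close.
- exact: (intg_product z.1 z.2 iu sk sk).
- exact: (measurable_product z.1 z.2 sk sk).
- by move=> y; rewrite mulr_ge0.
- exact: (moll_mass z sk k0 k1).
move=> y ky; apply: uc; have [_ sk0] := sk; split; apply/andP.
  apply: contrapT => H; move: ky; rewrite sk0 ?mul0r ?eqxx//.
  by move=> /andP[h1 h2]; apply: H; split; lra.
apply: contrapT => H; move: ky; rewrite (sk0 (y.2 - z.2)) ?mulr0 ?eqxx//.
by move=> /andP[h1 h2]; apply: H; split; lra.
Qed.

Lemma heat_at_moll (sigma r q a b : R) (u : R * R -> R) (k : R -> R) (z : R * R) :
  intg leb2 u -> supported a b k ->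
  heat_at sigma r q (moll u k) z
   ((- \int[leb2]_y (u y * (k (y.1 - z.1) * derive1 k (y.2 - z.2)))) -
    L_op sigma r q (moll u k z)
      (- \int[leb2]_y (u y * (derive1 k (y.1 - z.1) * k (y.2 - z.2))))
      (\int[leb2]_y (u y * (derive1 (derive1 k) (y.1 - z.1) * k (y.2 - z.2))))).
Proof.
move=> iu sk; have sk' := supported_derive sk.
exists (- \int[leb2]_y (u y * (k (y.1 - z.1) * derive1 k (y.2 - z.2)))),
  (fun x => - \int[leb2]_y (u y * (derive1 k (y.1 - x) * k (y.2 - z.2)))),
  (\int[leb2]_y (u y * (derive1 (derive1 k) (y.1 - z.1) * k (y.2 - z.2)))).
split => //.
- exact: (is_derive_moll_t z.1 z.2 iu sk sk).
- by move=> x; exact: (is_derive_moll_x x z.2 iu sk sk).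
- have := is_deriveN (is_derive_moll_x z.1 z.2 iu sk' sk).
  by rewrite opprK.
Qed.

End mollification.

(** * From weak derivatives to integral identities *)

Section weak_to_integral.
Context d (X : measurableType d) (R : realType) (mu : {measure set X -> \bar R}).

Lemma ae_imply (P P' : X -> Prop) : {ae mu, forall z, P z} ->
  (forall z, P z -> P' z) -> {ae mu, forall z, P' z}.
Proof. by move=> aeP PP'; exact: filterS PP' aeP. Qed.

Lemma Rintegral_ae_ge0 (h : X -> R) : intg mu h ->
  {ae mu, forall z, 0 <= h z} -> 0 <= \int[mu]_z h z.
Proof.
move=> ih h0.
have -> : \int[mu]_z h z = \int[mu]_z `|h z|.
  rewrite /Rintegral; congr fine; apply: ae_eq_integral => //.
  - exact: (measurable_int _ ih).
  - exact: (measurable_int _ (integrable_abse ih)).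
  - by apply: filterS h0 => z hz _; rewrite ger0_norm.
by apply: Rintegral_ge0.
Qed.

Lemma Rintegral_ae_eq0 (h : X -> R) : intg mu h ->
  {ae mu, forall z, h z = 0} -> \int[mu]_z h z = 0.
Proof.
move=> ih h0.
rewrite /Rintegral (ae_eq_integral (cst 0%E))//.
- by rewrite integral_cst// mul0e.
- exact: (measurable_int _ ih).
- by apply: filterS h0 => z hz _; rewrite hz.
Qed.

(** This is the commutation of the operator with mollification. The last three hypotheses are the
    integrations by parts against the kernel [f]. Keeping them abstract covers the evolution problem
    and, with [gt] and [ft] zero, the stationary one. *)
Lemma heat_integral (sigma r q : R) (u gx gxx gt f fx fxx ft : X -> R) :
  intg mu (fun z => u z * f z) -> intg mu (fun z => gx z * f z) ->
  intg mu (fun z => gxx z * f z) -> intg mu (fun z => gt z * f z) ->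
  (\int[mu]_z (u z * ft z) = - (\int[mu]_z (gt z * f z))) ->
  (\int[mu]_z (u z * fx z) = - (\int[mu]_z (gx z * f z))) ->
  (\int[mu]_z (u z * fxx z) = \int[mu]_z (gxx z * f z)) ->
  ((- (\int[mu]_z (u z * ft z))) -
    L_op sigma r q (\int[mu]_z (u z * f z)) (- (\int[mu]_z (u z * fx z)))
      (\int[mu]_z (u z * fxx z)) =
  \int[mu]_z ((gt z - L_op sigma r q (u z) (gx z) (gxx z)) * f z)) /\
  intg mu (fun z => (gt z - L_op sigma r q (u z) (gx z) (gxx z)) * f z).
Proof.
move=> iu ix ixx it -> -> ->; rewrite !opprK /L_op.
have e : (fun z => (gt z - (sigma ^+ 2 / 2 * gxx z +
      (r - q - sigma ^+ 2 / 2) * gx z - r * u z)) * f z) =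
    (fun z => gt z * f z + (- (sigma ^+ 2 / 2) * (gxx z * f z) +
      (- (r - q - sigma ^+ 2 / 2) * (gx z * f z) + r * (u z * f z)))).
  by apply/funext => z; ring.
have i1 := intgZ r iu.
have i2 := intgD (intgZ (- (r - q - sigma ^+ 2 / 2)) ix) i1.
have i3 := intgD (intgZ (- (sigma ^+ 2 / 2)) ixx) i2.
rewrite e; split; last exact: intgD.
rewrite RintegralD// RintegralD//; last exact: intgZ.
rewrite RintegralD//; last exact: intgZ.
by rewrite !RintegralZl//; ring.
Qed.

(** Weak derivatives integrate over the open domain, mollifications over the whole space against a
    truncated function; the two agree when the kernel is supported in the truncation set. *)
Lemma Rintegral_restrict (Om D B : set X) (f h : X -> R) :
  (forall y, h y != 0 -> B y) -> B `<=` D -> D `<=` Om ->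
  \int[mu]_(y in Om) (f y * h y) = \int[mu]_y ((f \_ D) y * h y).
Proof.
move=> hB BD DO; rewrite Rintegral_mkcond; apply: eq_Rintegral => y _.
have [hy|hy] := eqVneq (h y) 0.
  by rewrite hy mulr0 patchE; case: ifP => // _; rewrite hy mulr0.
have Dy := BD _ (hB _ hy); have Oy := DO _ Dy.
by rewrite !patchE !ifT//; exact/mem_set.
Qed.

(** On [D] the function is dominated by [|f|^p + 1], and the constant is integrable over the larger
    set [E] of finite measure, so [D] itself is never shown to be measurable. *)
Lemma Lp_intg (p : R) (D E : set X) (f : X -> R) : 1 < p -> Lp_on mu p D f ->
  D `<=` E -> measurable E -> (mu E < +oo)%E -> intg mu (f \_ D).
Proof.
move=> p1 fp DE mE muE.
have mf : measurable_fun setT (f \_ D).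
  by have := sub_Lfun_mfun fp; rewrite inE.
have i1 : mu.-integrable setT (fun x => (`|(f \_ D) x| `^ p)%:E).
  exact: Lfun_integrable (ltW p1) fp.
have i2 : mu.-integrable setT (fun x => (\1_E x)%:E).
  apply/integrableP; split; first exact/measurable_EFinP.
  rewrite (eq_integral (fun x => (\1_E x)%:E)).
    by rewrite integral_indic// setIT.
  by move=> t _; rewrite gee0_abs// lee_fin.
apply: (le_integrable measurableT _ _ (integrableD measurableT i1 i2)).
  exact/measurable_EFinP.
move=> x _; rewrite /= lee_fin [leRHS]ger0_norm; last first.
  by rewrite addr_ge0// powR_ge0.
have [xE|xE] := pselect (E x); last first.
  by rewrite patchE ifF ?normr0 ?addr_ge0 ?powR_ge0//; apply/negP => /set_mem/DE.
rewrite indicE mem_set//=.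
have [h1|h1] := leP `|(f \_ D) x| 1; first by rewrite (le_trans h1)// lerDr powR_ge0.
by rewrite ler_wpDr// le1r_powR// ltW.
Qed.

End weak_to_integral.

(** * Products of kernels as test functions *)

Section product_test.
Context {R : realType}.
Notation leb2 := (@lebesgue2 R).

Lemma supported_shift (a b x : R) (f : R -> R) : supported a b f ->
  supported (x + a) (x + b) (fun s => f (s - x)) /\
  (forall s, is_derive s (1 : R) (fun s => f (s - x)) (derive1 f (s - x))).
Proof.
move=> [Cf f0].
have e : (fun s => f (s - x)) = (fun s => f (1 * s - x)).
  by apply/funext => s; rewrite mul1r.
split; last first.
  move=> s; rewrite e -[derive1 f _]mul1r; apply: is_derive_affine; rewrite mul1r.
  by have [_] := Cinf_derive Cf; apply.
split; first by rewrite e => n; exact: Cn_affine.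
by move=> s H; apply: f0 => /andP[h1 h2]; apply: H; apply/andP; split; lra.
Qed.

Definition prodf (f g : R -> R) (z y : R * R) : R := f (y.1 - z.1) * g (y.2 - z.2).

Lemma prodf_supp (a b : R) (f g : R -> R) (z y : R * R) :
  supported a b f -> supported a b g -> prodf f g z y != 0 ->
  box (z.1 + a) (z.1 + b) (z.2 + a) (z.2 + b) y.
Proof.
move=> [_ f0] [_ g0] H; rewrite /prodf in H; split.
  apply: contrapT => h; move: H; rewrite f0 ?mul0r ?eqxx// => /andP[h1 h2].
  by apply: h; apply/andP; split; lra.
apply: contrapT => h; move: H; rewrite (g0 (y.2 - _)) ?mulr0 ?eqxx// => /andP[h1 h2].
by apply: h; apply/andP; split; lra.
Qed.

Lemma prodf_test (a b : R) (Om : set (R * R)) (f g : R -> R) (z : R * R) :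
  supported a b f -> supported a b g ->
  box (z.1 + a) (z.1 + b) (z.2 + a) (z.2 + b) `<=` Om ->
  test_function Om (prodf f g z).
Proof.
move=> sf sg BO; split.
  apply: ridge_smooth.
  have [[Cf _] _] := supported_shift z.1 sf.
  have [[Cg _] _] := supported_shift z.2 sg.
  exact: (@ridge_prod _ _ fst snd _ _ (fun=> cvg_fst) (fun=> cvg_snd) Cf Cg).
exists (box (z.1 + a) (z.1 + b) (z.2 + a) (z.2 + b)); split => //.
  exact: box_compact.
by move=> y; apply: contra_notP => /eqP; exact: prodf_supp.
Qed.

Lemma prodf_derive (a b : R) (f g : R -> R) (z v y : R * R) :
  supported a b f -> supported a b g ->
  'D_v (prodf f g z) y =
    v.1 * prodf (derive1 f) g z y + v.2 * prodf f (derive1 g) z y.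
Proof.
move=> sf sg.
have [_ df] := supported_shift z.1 sf.
have [_ dg] := supported_shift z.2 sg.
have [_ d1] := @is_derive_comp_linear _ _ (fst : {linear (R * R)%type -> R}) _ y v _ (fun=> cvg_fst) (df y.1).
have [_ d2] := @is_derive_comp_linear _ _ (snd : {linear (R * R)%type -> R}) _ y v _ (fun=> cvg_snd) (dg y.2).
have [_ ->] := is_deriveM d1 d2.
by rewrite /prodf /GRing.scale/=; ring.
Qed.

End product_test.

(** * Mollified solutions *)

Section solution_moll.
Context {R : realType}.
Notation leb := (@lebesgue_measure R).
Notation leb2 := (@lebesgue2 R).

Lemma prodf_dx (a b : R) (f g : R -> R) (z : R * R) :
  supported a b f -> supported a b g ->
  forall y, 'D_x_dir (prodf f g z) y = prodf (derive1 f) g z y.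
Proof.
move=> sf sg y; rewrite (prodf_derive _ _ _ sf sg) /x_dir /=.
by rewrite mul1r mul0r addr0.
Qed.

Lemma prodf_dt (a b : R) (f g : R -> R) (z : R * R) :
  supported a b f -> supported a b g ->
  forall y, 'D_t_dir (prodf f g z) y = prodf f (derive1 g) z y.
Proof.
move=> sf sg y; rewrite (prodf_derive _ _ _ sf sg) /t_dir /=.
by rewrite mul1r mul0r add0r.
Qed.

Lemma box_finite (xl xr tb te : R) :
  measurable (box xl xr tb te : set (measurableTypeR R * measurableTypeR R)) /\
  (leb2 (box xl xr tb te) < +oo)%E.
Proof.
have -> : box xl xr tb te = `[xl, xr] `*` `[tb, te].
  by apply/seteqP; split => -[x t]; rewrite /box/= !in_itv.
split; first exact: measurableX.
rewrite /lebesgue2 product_measure1E//= !lebesgue_measure_itv/=.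
by case: ifP => _; case: ifP => _; rewrite ?mule0 ?mul0e// -!EFinB -EFinM ltry.
Qed.

(** The value [v] is the integral of the heat expression of [Y] against a nonnegative kernel, so the
    almost everywhere inequality gives its sign. If the obstacle is strictly below [Y] on the whole
    window, the integrand vanishes almost everywhere. Truncation to [Q_cut] keeps clear of the
    corner where the derivatives need not be integrable. *)
Lemma strong_solution_moll (K1 k2 K2 sigma r q T p M rho : R) (Y : R * R -> R) :
  1 < p -> strong_solution K1 k2 K2 sigma r q T p Y -> 0 < M -> 0 < rho ->
  let D := Q_cut k2 K2 T M rho in
  intg leb2 (Y \_ D) /\ forall e k z, supported (- (2 * e)) (- e) k ->
    (forall x, 0 <= k x) ->
    box (z.1 - 2 * e) (z.1 - e) (z.2 - 2 * e) (z.2 - e) `<=` D ->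
  exists v, [/\ heat_at sigma r q (moll (Y \_ D) k) z v, 0 <= v &
    (forall y, box (z.1 - 2 * e) (z.1 - e) (z.2 - 2 * e) (z.2 - e) y ->
        psi2 K1 k2 K2 y.1 < Y y) -> v = 0].
Proof.
move=> p1 [Yx [Yxx [Yt [[_ wx wxx wt HL] _ sup eqn _]]]] M0 rho0 D.
have [LY LYx LYxx LYt] := HL _ _ M0 rho0.
have [mE fE] := box_finite (- M) M 0 T.
have DE : D `<=` box (- M) M 0 T.
  by move=> y [_ /andP[h1 h2] /andP[h3 h4] _]; split; apply/andP; split; exact: ltW.
have DO : D `<=` Q_interior k2 T by move=> y [].
have [iY iYx iYxx iYt] : [/\ intg leb2 (Y \_ D), intg leb2 (Yx \_ D),
    intg leb2 (Yxx \_ D) & intg leb2 (Yt \_ D)].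
  split.
  - exact: (Lp_intg p1 LY DE mE fE).
  - exact: (Lp_intg p1 LYx DE mE fE).
  - exact: (Lp_intg p1 LYxx DE mE fE).
  - exact: (Lp_intg p1 LYt DE mE fE).
split => // e k z sk k0 BD.
have sk' := supported_derive sk; have sk'' := supported_derive sk'.
have BO := subset_trans BD DO.
have tt (f g : R -> R) : supported (- (2 * e)) (- e) f ->
    supported (- (2 * e)) (- e) g -> test_function (Q_interior k2 T) (prodf f g z).
  by move=> sf sg; exact: prodf_test sf sg BO.
have rr (f g : R -> R) (H : R * R -> R) : supported (- (2 * e)) (- e) f ->
    supported (- (2 * e)) (- e) g ->
    \int[leb2]_(y in Q_interior k2 T) (H y * prodf f g z y) =
    \int[leb2]_y ((H \_ D) y * prodf f g z y).
  move=> sf sg.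
  have HH := (Rintegral_restrict leb2 H (fun y => @prodf_supp _ _ _ _ _ z y sf sg) BD DO).
  exact: HH.
have H1 : \int[leb2]_y ((Y \_ D) y * prodf k (derive1 k) z y) =
    - (\int[leb2]_y ((Yt \_ D) y * prodf k k z y)).
  have := wt _ (tt _ _ sk sk).
  by under eq_Rintegral do rewrite (prodf_dt z sk sk); rewrite !rr.
have H2 : \int[leb2]_y ((Y \_ D) y * prodf (derive1 k) k z y) =
    - (\int[leb2]_y ((Yx \_ D) y * prodf k k z y)).
  have := wx _ (tt _ _ sk sk).
  by under eq_Rintegral do rewrite (prodf_dx z sk sk); rewrite !rr.
(* Two integrations by parts, the first one with [prodf (derive1 k) k z] as test function. *)
have H3 : \int[leb2]_y ((Y \_ D) y * prodf (derive1 (derive1 k)) k z y) =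
    \int[leb2]_y ((Yxx \_ D) y * prodf k k z y).
  have := wx _ (tt _ _ sk' sk).
  under eq_Rintegral do rewrite (prodf_dx z sk' sk).
  rewrite !rr// => ->.
  have := wxx _ (tt _ _ sk sk).
  by under eq_Rintegral do rewrite (prodf_dx z sk sk); rewrite !rr// => ->; rewrite opprK.
have ip (H : R * R -> R) : intg leb2 H -> intg leb2 (fun y => H y * prodf k k z y).
  by move=> iH; exact: (intg_product z.1 z.2 iH sk sk).
have [Hv iv] := heat_integral sigma r q (ip _ iY) (ip _ iYx) (ip _ iYxx) (ip _ iYt) H1 H2 H3.
have BQ y : prodf k k z y != 0 ->
    [/\ box (z.1 - 2 * e) (z.1 - e) (z.2 - 2 * e) (z.2 - e) y, y \in D & Q k2 T y].
  move=> /(prodf_supp sk sk) By; split => //; first exact/mem_set/BD.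
  by have [? /andP[? ?]] := BO _ By; split => //; apply/andP; split => //; exact: ltW.
eexists; split; first exact: heat_at_moll iY sk.
- rewrite [X in 0 <= X]Hv; apply: Rintegral_ae_ge0 iv _.
  apply: (ae_imply sup) => y Hy.
  have [->|/BQ[_ yD /Hy]] := eqVneq (prodf k k z y) 0; first by rewrite mulr0.
  by move=> hy; rewrite !patchE yD mulr_ge0// /prodf mulr_ge0.
- move=> HY; rewrite [LHS]Hv; apply: Rintegral_ae_eq0 iv _.
  apply: (ae_imply eqn) => y Hy.
  have [->|/BQ[/HY Yy yD /Hy]] := eqVneq (prodf k k z y) 0; first by rewrite mulr0.
  by move=> /(_ Yy) hy; rewrite !patchE yD hy mul0r.
Qed.

(** It takes a space-time point and ignores the time, so that stationary approximants fit [heat_at]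
    directly. *)
Definition moll1 (u k : R -> R) (z : R * R) : R :=
  \int[leb]_y (u y * k (y - z.1)).

Lemma intg_shift (a b : R) (u k : R -> R) (x : R) :
  intg leb u -> supported a b k -> intg leb (fun y => u y * k (y - x)).
Proof.
move=> iu sk; have [M _ kM] := supported_bounded sk.
have [sk' _] := supported_shift x sk.
exact: (intg_mul iu (supported_measurable sk') (fun y => kM (y - x))).
Qed.

Lemma is_derive_moll1 (a b : R) (u k : R -> R) (x : R) :
  intg leb u -> supported a b k ->
  is_derive x (1 : R) (fun x => \int[leb]_y (u y * k (y - x)))
    (- (\int[leb]_y (u y * derive1 k (y - x)))).
Proof.
move=> iu sk.
have mid : measurable_fun setT (fun y : measurableTypeR R => y : R).
  exact: measurable_id.
have H := is_derive_convolution iu mid sk x.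
exact: H.
Qed.

Lemma moll1_continuous (a b : R) (u k : R -> R) :
  intg leb u -> supported a b k -> continuous (moll1 u k).
Proof.
move=> iu sk z.
apply: (@continuous_comp _ _ _ fst (fun x => \int[leb]_y (u y * k (y - x)))).
  exact: cvg_fst.
apply/differentiable_continuous/derivable1_diffP.
by have [] := is_derive_moll1 z.1 iu sk.
Qed.

Lemma moll1_close (e c eta : R) (u k : R -> R) (z : R * R) :
  intg leb u -> supported (- (2 * e)) (- e) k ->
  (forall x, 0 <= k x) -> (forall x, (\int[leb]_y (k (y - x))%:E = 1)%E) ->
  (forall y, z.1 - 2 * e <= y <= z.1 - e -> `|u y - c| <= eta) ->
  `|moll1 u k z - c| <= eta.
Proof.
move=> iu sk k0 k1 uc.
have [sk' _] := supported_shift z.1 sk.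
apply: average_close => //; first exact: (intg_shift z.1 iu sk).
  exact: supported_measurable sk'.
move=> y ky; apply: uc; have [_ sk0] := sk'; apply: contrapT => H.
by move: ky; rewrite sk0 ?eqxx.
Qed.

Lemma stationary_solution_moll (K1 k2 K2 sigma r q p c b : R) (V : R -> R) :
  1 < p -> stationary_solution K1 k2 K2 sigma r q p V -> ln k2 < c ->
  let D := `[c, b]%classic in
  intg leb (V \_ D) /\ forall e k z, supported (- (2 * e)) (- e) k ->
    (forall x, 0 <= k x) -> c <= z.1 - 2 * e -> z.1 - e <= b ->
  exists2 v, heat_at sigma r q (moll1 (V \_ D) k) z v & 0 <= v.
Proof.
move=> p1 [_ _ _ _ [V1 [V2 [[w1 w2 HL] sup _]]]] kc D.
have cD : compact D by exact: segment_compact.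
have DO : D `<=` [set x | ln k2 < x].
  by move=> x; rewrite /D /= in_itv/= => /andP[cx _]; exact: lt_le_trans cx.
have [LV LV1 LV2] := HL _ cD DO.
have mD : measurable D by exact: measurable_itv.
have fD : (leb D < +oo)%E.
  by rewrite lebesgue_measure_itv/=; case: ifP => _; rewrite -?EFinB ?ltry.
have [iV iV1 iV2] : [/\ intg leb (V \_ D), intg leb (V1 \_ D) & intg leb (V2 \_ D)].
  split.
  - exact: (Lp_intg p1 LV (@subset_refl _ D) mD fD).
  - exact: (Lp_intg p1 LV1 (@subset_refl _ D) mD fD).
  - exact: (Lp_intg p1 LV2 (@subset_refl _ D) mD fD).
split => // e k z sk k0 cz zb.
have sk' := supported_derive sk; have sk'' := supported_derive sk'.
pose B : set R := [set y | z.1 - 2 * e <= y <= z.1 - e].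
have BD : B `<=` D.
  by move=> y /andP[h1 h2]; rewrite /D /= in_itv/=; apply/andP; split; lra.
have supp f : supported (- (2 * e)) (- e) f -> forall y, f (y - z.1) != 0 -> B y.
  move=> /(supported_shift z.1)[[_ f0] _] y; apply: contra_neqP.
  exact: f0.
have tt (f : R -> R) : supported (- (2 * e)) (- e) f ->
    test_function [set x | ln k2 < x] (fun y => f (y - z.1)).
  move=> sf; have [[Cf _] _] := supported_shift z.1 sf; split.
    rewrite (_ : (fun y => _) = (fun y => f (y - z.1) * cst 1 y)); last first.
      by apply/funext => y; rewrite mulr1.
    apply: ridge_smooth.
    have cid : continuous (idfun : R -> R) by move=> x; exact: cvg_id.
    exact: (@ridge_prod R R idfun idfun _ _ cid cid Cf (fun n => Cn_cst n 1)).
  exists (`[z.1 - 2 * e, z.1 - e]%classic); split; first exact: segment_compact.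
    by apply: subset_trans DO => y; rewrite /= in_itv/=; exact: BD.
  move=> y; apply: contra_notP => /eqP /(supp _ sf) By.
  by rewrite /= in_itv.
have dd (f : R -> R) : supported (- (2 * e)) (- e) f ->
    derive1 (fun y => f (y - z.1)) = (fun y => derive1 f (y - z.1)).
  move=> /(supported_shift z.1)[_ df]; apply/funext => y.
  by rewrite derive1E; have [_ ->] := df y.
have rr (f H : R -> R) : supported (- (2 * e)) (- e) f ->
    \int[leb]_(y in [set x | ln k2 < x]) (H y * f (y - z.1)) =
    \int[leb]_y ((H \_ D) y * f (y - z.1)).
  move=> sf; have HH := Rintegral_restrict leb H (supp _ sf) BD DO.
  exact: HH.
have H2 : \int[leb]_y ((V \_ D) y * derive1 k (y - z.1)) =
    - (\int[leb]_y ((V1 \_ D) y * k (y - z.1))).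
  by have := w1 _ (tt _ sk); rewrite dd// !rr.
have H3 : \int[leb]_y ((V \_ D) y * derive1 (derive1 k) (y - z.1)) =
    \int[leb]_y ((V2 \_ D) y * k (y - z.1)).
  have := w1 _ (tt _ sk'); rewrite dd// !rr// => ->.
  by have := w2 _ (tt _ sk); rewrite dd// !rr// => ->; rewrite opprK.
have i0 : intg leb (fun=> 0) by exact: integrable0.
have H1 : \int[leb]_y ((V \_ D) y * 0) = - (\int[leb]_y (0 * k (y - z.1))).
  have -> : (fun y => (V \_ D) y * 0) = (fun=> 0) by apply/funext => y; rewrite mulr0.
  have -> : (fun y => 0 * k (y - z.1)) = (fun=> 0) by apply/funext => y; rewrite mul0r.
  by rewrite /Rintegral integral0 oppr0.
have ip (H : R -> R) : intg leb H -> intg leb (fun y => H y * k (y - z.1)).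
  by move=> iH; exact: (intg_shift z.1 iH sk).
have [Hv iv] := heat_integral sigma r q (ip _ iV) (ip _ iV1) (ip _ iV2) (ip _ i0) H1 H2 H3.
have z0 : \int[leb]_y ((V \_ D) y * 0) = 0.
  have -> : (fun y => (V \_ D) y * 0) = (fun=> 0) by apply/funext => y; rewrite mulr0.
  by rewrite /Rintegral integral0.
rewrite z0 oppr0 in Hv.
exists (0 - L_op sigma r q (moll1 (V \_ D) k z)
   (- (\int[leb]_y ((V \_ D) y * derive1 k (y - z.1))))
   (\int[leb]_y ((V \_ D) y * derive1 (derive1 k) (y - z.1)))).
  exists 0, (fun x => - (\int[leb]_y ((V \_ D) y * derive1 k (y - x)))),
    (\int[leb]_y ((V \_ D) y * derive1 (derive1 k) (y - z.1))).
  split => //.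
  - exact: (is_derive_cst (moll1 (V \_ D) k z) z.2 (1 : R)).
  - by move=> x; exact: (is_derive_moll1 x iV sk).
  - by have := is_deriveN (is_derive_moll1 z.1 iV sk'); rewrite opprK.
rewrite [X in 0 <= X]Hv; apply: Rintegral_ae_ge0 iv _.
apply: (ae_imply sup) => y Hy.
have [->|/(supp _ sk) By] := eqVneq (k (y - z.1)) 0; first by rewrite mulr0.
have yD := BD _ By; have := Hy (DO _ yD).
by move=> hy; rewrite !patchE mem_set// mulr_ge0// sub0r.
Qed.

End solution_moll.

(** * Explicit barriers *)

Section barrier.
Context {R : realType}.

(** For [c = (k2 - K1) / (n2 - n1)] this is the profile G. The weights [n2] and [- n1] give it slope
    zero at [0], the smooth fit with the constant branch; [capped'] is its derivative. *)
Definition capped (c n1 n2 u : R) : R := c * (n2 * expR (n1 * u) - n1 * expR (n2 * u)).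
Definition capped' (c n1 n2 u : R) : R := c * n1 * n2 * (expR (n1 * u) - expR (n2 * u)).

Lemma expR_tangent (m u u0 : R) : expR (m * u0) * (1 + m * (u - u0)) <= expR (m * u).
Proof.
have -> : expR (m * u) = expR (m * u0) * expR (m * (u - u0)).
  by rewrite -expRD; congr expR; ring.
by rewrite ler_pM2l ?expR_gt0// expR_ge1Dx.
Qed.

(** Convexity: both exponentials enter with positive weights [c * n2] and [c * - n1], and each lies
    above its tangents. *)
Lemma capped_tangent (c n1 n2 u u0 : R) : 0 < c -> n1 < 0 -> 0 < n2 ->
  capped c n1 n2 u0 + capped' c n1 n2 u0 * (u - u0) <= capped c n1 n2 u.
Proof.
move=> c0 n10 n20; rewrite /capped /capped'.
have h1 : 0 <= c * n2 * (expR (n1 * u) - expR (n1 * u0) * (1 + n1 * (u - u0))).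
  by rewrite mulr_ge0 ?subr_ge0 ?expR_tangent// mulr_ge0// ltW.
have h2 : 0 <= c * - n1 * (expR (n2 * u) - expR (n2 * u0) * (1 + n2 * (u - u0))).
  by rewrite mulr_ge0 ?subr_ge0 ?expR_tangent// mulr_ge0 ?oppr_ge0// ltW.
lra.
Qed.

Lemma capped_min (k n1 n2 u : R) : 0 < k -> n1 < 0 -> 0 < n2 ->
  capped (k / (n2 - n1)) n1 n2 0 = k /\ k <= capped (k / (n2 - n1)) n1 n2 u.
Proof.
move=> k0 n10 n20.
have c0 : 0 < k / (n2 - n1) by rewrite divr_gt0//; lra.
have e0 : capped (k / (n2 - n1)) n1 n2 0 = k.
  by rewrite /capped !mulr0 expR0 !mulr1 mulfVK//; lra.
split => //.
have := capped_tangent u 0 c0 n10 n20.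
by rewrite e0 /capped' !mulr0 subrr mulr0 mul0r addr0.
Qed.

Lemma is_derive_expRM (m a x : R) :
  is_derive x (1 : R) (fun x => expR (m * (x - a))) (m * expR (m * (x - a))).
Proof.
have e y : m * (y - a) = m * y + - (m * a) by ring.
rewrite (_ : (fun x => _) = (fun x => expR (m * x + - (m * a)))).
  by rewrite e; apply: is_derive_affine; exact: is_derive_expR.
by apply/funext => y; rewrite e.
Qed.

Lemma is_derive_capped (c n1 n2 a x : R) :
  is_derive x (1 : R) (fun x => capped c n1 n2 (x - a)) (capped' c n1 n2 (x - a)) /\
  is_derive x (1 : R) (fun x => capped' c n1 n2 (x - a))
    (c * n1 * n2 * (n1 * expR (n1 * (x - a)) - n2 * expR (n2 * (x - a)))).
Proof.
have d1 := is_derive_expRM n1 a x; have d2 := is_derive_expRM n2 a x.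
split.
  have H : is_derive x (1 : R) (fun x => capped c n1 n2 (x - a)) _ :=
    is_deriveZ c (is_deriveB (is_deriveZ n2 d1) (is_deriveZ n1 d2)).
  by apply: (is_derive_eq H); rewrite /capped' /GRing.scale/=; ring.
by have := is_deriveZ (c * n1 * n2) (is_deriveB d1 d2).
Qed.

Lemma L_op_expR (sigma r q n E : R) : char_root sigma r q n ->
  L_op sigma r q E (n * E) (n * (n * E)) = 0.
Proof.
move=> hn; rewrite /L_op -[RHS](mulr0 E) -[in RHS]hn; ring.
Qed.

Lemma L_op_capped (sigma r q c n1 n2 u : R) :
  char_root sigma r q n1 -> char_root sigma r q n2 ->
  L_op sigma r q (capped c n1 n2 u) (capped' c n1 n2 u)
    (c * n1 * n2 * (n1 * expR (n1 * u) - n2 * expR (n2 * u))) = 0.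
Proof.
move=> /(L_op_expR (expR (n1 * u))) h1 /(L_op_expR (expR (n2 * u))) h2.
rewrite (_ : L_op _ _ _ _ _ _ =
  c * n2 * L_op sigma r q (expR (n1 * u)) (n1 * expR (n1 * u)) (n1 * (n1 * expR (n1 * u))) -
  c * n1 * L_op sigma r q (expR (n2 * u)) (n2 * expR (n2 * u)) (n2 * (n2 * expR (n2 * u)))).
  by rewrite h1 h2 !mulr0 subrr.
by rewrite /L_op /capped /capped'; ring.
Qed.

Lemma expR_grows (c n M x0 : R) : 0 < c -> 0 < n ->
  exists2 x, x0 <= x & M <= c * expR (n * x).
Proof.
move=> c0 n0; exists (Num.max x0 (M / (c * n))); first by rewrite le_max lexx.
set x := Num.max _ _.
have h1 : M / (c * n) <= x by rewrite le_max lexx orbT.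
have h2 : M <= c * (n * x).
  by move: h1; rewrite ler_pdivrMr ?mulr_gt0// => h; apply: le_trans h _; lra.
apply: le_trans h2 _; rewrite ler_pM2l//.
by apply: le_trans (expR_ge1Dx _); rewrite lerDr.
Qed.

Lemma psi2_cases (K1 k2 K2 x : R) :
  [/\ k2 - K1 <= psi2 K1 k2 K2 x, K2 - expR x + k2 - K1 <= psi2 K1 k2 K2 x &
   forall m, k2 - K1 <= m -> K2 - expR x + k2 - K1 <= m -> psi2 K1 k2 K2 x <= m].
Proof.
rewrite /psi2; case: (leP (K2 - expR x) 0) => h; split; try lra;
  move=> m h1 h2; lra.
Qed.

(* The stationary profile [capped (x - a)] extends to a global majorant of the
   obstacle solving the elliptic equation, which touches it at [a] and [bk2]. *)
Lemma barrierP (K1 k2 K2 n1 n2 a bk2 : R) : 0 < K1 -> K1 < k2 -> k2 < K2 ->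
  n1 < 0 -> 0 < n2 -> stationary_boundaries K1 k2 K2 n1 n2 a bk2 ->
  let g x := capped ((k2 - K1) / (n2 - n1)) n1 n2 (x - a) in
  [/\ forall x, ln k2 <= x -> psi2 K1 k2 K2 x <= g x, g a = k2 - K1,
      ln k2 <= bk2 <= ln K2, g bk2 = K2 - expR bk2 + k2 - K1 & ln K2 <= a].
Proof.
move=> K10 Kk kK n10 n20 [y [b [y01 fy hb case1 case2]]] g.
have k20 : 0 < k2 by lra.
have K20 : 0 < K2 by lra.
have kK0 : 0 < k2 - K1 by lra.
pose c := (k2 - K1) / (n2 - n1).
have c0 : 0 < c by rewrite divr_gt0//; lra.
have gmin x : k2 - K1 <= g x by have [] := capped_min (x - a) kK0 n10 n20.
have ga : g a = k2 - K1.
  by rewrite /g subrr; have [] := capped_min 0 kK0 n10 n20.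
have expk2 : expR (ln k2) = k2 by rewrite lnK.
(* Domination of the put branch is the core. Domination of the constant branch is [gmin]; comparing
   the put branch with [g] at [bk2] and at [a] places these points on either side of [ln K2]. *)
suff [h1 h2 h3 h4] : [/\ forall x, ln k2 <= x -> K2 - expR x + k2 - K1 <= g x,
    ln k2 <= bk2, g bk2 = K2 - expR bk2 + k2 - K1 & ln k2 <= a].
  have hpsi x : ln k2 <= x -> psi2 K1 k2 K2 x <= g x.
    by move=> /h1 hx; have [_ _] := psi2_cases K1 k2 K2 x; apply.
  split => //.
    rewrite h2 -ler_expR lnK//.
    by have := gmin bk2; rewrite h3; lra.
  rewrite -ler_expR lnK//.
  by have := h1 a h4; rewrite ga; lra.
have y0 : 0 < y by case/andP: y01.
have y1 : y < 1 by case/andP: y01.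
set eta := ln y.
have ey : y = expR eta by rewrite lnK.
have eta0 : eta < 0 by apply: ln_lt0.
have pw n : y `^ n = expR (n * eta) by rewrite mulrC expRM -ey.
(* The formulas for [y] and [b] encode smooth fit with the put branch at offset [eta]: the
   definition of [expR b] matches the slopes, and the root of [f_tilde] matches the values. *)
have hb' : capped' c n1 n2 eta = - expR b.
  by rewrite hb /capped' !pw /c; ring.
have fy' : capped c n1 n2 eta + expR b = K2 + k2 - K1.
  move: fy; rewrite /f_tilde !pw -/c => fy.
  have e : capped c n1 n2 eta - capped' c n1 n2 eta = c * (n2 * (1 - n1) * expR (n1 * eta) +
      n1 * (n2 - 1) * expR (n2 * eta)) by rewrite /capped /capped'; ring.
  by move: e; rewrite hb' opprK => ->; apply/eqP; rewrite -subr_eq0 fy.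
(* In the first case the concave put branch and the convex [g] share their tangent at [b], which
   separates them. *)
have [kb|bk] := leP (ln k2) b.
  have [ea ->] := case1 kb.
  have ba : b - a = eta.
    by apply: expR_inj; rewrite expRB ea -ey invfM invrK mulrA mulfV ?mul1r// expR_eq0.
  split => //.
  - move=> x _.
    change (K2 - expR x + k2 - K1 <= capped c n1 n2 (x - a)).
    have := capped_tangent (x - a) eta c0 n10 n20; rewrite hb' -ba.
    have -> : x - a - (b - a) = x - b by ring.
    have := expR_tangent 1 x b; rewrite !mul1r => h5.
    move: fy'; rewrite -ba => fy' h6.
    have : expR b + expR b * (x - b) <= expR x by rewrite -{1}[expR b]mulr1 -mulrDr.
    by move: h6; rewrite mulNr; lra.
  - by move: fy'; rewrite -ba -/(g b); lra.
  - by apply: le_trans kb _; lra.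
have [[z0 [z01 gz ea]] ->] := case2 bk.
have z00 : 0 < z0 by case/andP: z01.
set l := ln k2.
have la : l - a = ln z0.
  apply: expR_inj; rewrite expRB ea expk2 lnK// invfM invrK mulrA mulfV ?mul1r//.
  by rewrite gt_eqF.
have lneg : l - a < 0 by rewrite la; exact: ln_lt0.
have pwz n : z0 `^ n = expR (n * (l - a)) by rewrite mulrC expRM la lnK.
have gl : capped c n1 n2 (l - a) = K2 - K1.
  by move: gz; rewrite /g_tilde !pwz /capped -/c; lra.
have ebk : expR b < k2 by rewrite -expk2 ltr_expR.
(* At the cap only the values match. The slope of the put branch there is [- k2], and a slope of [g]
   at least as large keeps [g] above to the right. It follows from monotonicity of [capped'] once
   [eta <= l - a]; otherwise the tangent at [eta] would force a value above [K2 - K1] at [l - a]. *)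
have slope : - k2 <= capped' c n1 n2 (l - a).
  have eta_l : eta <= l - a.
    rewrite leNgt; apply/negP => le.
    have := capped_tangent (l - a) eta c0 n10 n20; rewrite hb' gl.
    have : 0 <= expR b * (eta - (l - a)) by rewrite mulr_ge0 ?expR_ge0//; lra.
    move: fy' => fy'; lra.
  apply: (@le_trans _ _ (capped' c n1 n2 eta)); first by rewrite hb'; lra.
  have cn : c * n1 * n2 < 0 by rewrite pmulr_llt0// pmulr_rlt0.
  rewrite /capped' (ler_nM2l cn); apply: lerB.
    by rewrite ler_expR (ler_nM2l n10).
  by rewrite ler_expR (ler_pM2l n20).
split => //.
- move=> x lx.
  change (K2 - expR x + k2 - K1 <= capped c n1 n2 (x - a)).
  have := capped_tangent (x - a) (l - a) c0 n10 n20; rewrite gl.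
  have -> : x - a - (l - a) = x - l by ring.
  have := expR_tangent 1 x l; rewrite !mul1r expk2 => h5.
  have : 0 <= (capped' c n1 n2 (l - a) + k2) * (x - l) by rewrite mulr_ge0//; lra.
  by lra.
- by rewrite /g -/c gl expk2; lra.
- by lra.
Qed.

End barrier.

(** * Comparison principles *)

Lemma continuous_within_comp (R : realType) (S : topologicalType) (f : S -> R)
    (A : set S) (c : R * R -> S) :
  {within A, continuous f} -> continuous c -> (forall z, A (c z)) ->
  continuous (f \o c).
Proof.
move=> /subspace_continuousP cf cc Ac z U HU.
have H := cf _ (Ac z) U HU.
have H2 : nbhs z (fun y : R * R => A (c y) -> U (f (c y))) := cc z _ H.
by apply: (@filterS _ (nbhs z) _ (fun y : R * R => A (c y) -> U (f (c y))) _ _ H2)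
  => y; apply; exact: Ac.
Qed.

Lemma continuous_max_fst (R : realType) (a : R) :
  continuous (fun z : R * R => Num.max z.1 a).
Proof.
by move=> z; apply: (@continuous_max _ _ (fun z : R * R => z.1) (cst a));
  [exact: cvg_fst|exact: cvg_cst].
Qed.

(** Projection onto the closed strip extends [Y] continuously to the whole plane, as
    [parabolic_comparison] requires, without changing it on the strip. *)
Definition clampY {R : realType} (k2 T : R) (Y : R * R -> R) (z : R * R) : R :=
  Y (Num.max z.1 (ln k2), Num.min (Num.max z.2 0) T).

Lemma clampYE (R : realType) (k2 T : R) (Y : R * R -> R) z :
  Q_closed k2 T z -> clampY k2 T Y z = Y z.
Proof.
case: z => x t [/= h1 /andP[h2 h3]]; rewrite /clampY /=.
by rewrite (max_idPl h1) (max_idPl h2) (min_idPl h3).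
Qed.

Lemma clampY_continuous (R : realType) (k2 T : R) (Y : R * R -> R) : 0 < T ->
  {within Q_closed k2 T, continuous Y} -> continuous (clampY k2 T Y).
Proof.
move=> T0 cY.
apply: (@continuous_within_comp _ _ Y (Q_closed k2 T)
  (fun z => (Num.max z.1 (ln k2), Num.min (Num.max z.2 0) T))) => //.
  move=> z.
  have h1 := @continuous_max_fst _ (ln k2) z.
  have h2 : (fun z : R * R => Num.min (Num.max z.2 0) T) x @[x --> z]
      --> Num.min (Num.max z.2 0) T.
    apply: (@continuous_min _ _ (fun z : R * R => Num.max z.2 0) (cst T)); last exact: cvg_cst.
    by apply: (@continuous_max _ _ (fun z : R * R => z.2) (cst 0));
      [exact: cvg_snd|exact: cvg_cst].
  exact: (cvg_pair h1 h2).
move=> z; split; rewrite /= ?le_max ?lexx ?orbT//.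
by rewrite le_min le_max lexx orbT (ltW T0) ge_min lexx orbT.
Qed.

Lemma strong_solution_continuous (R : realType) (K1 k2 K2 sigma r q T p : R) Y :
  0 < T -> strong_solution K1 k2 K2 sigma r q T p Y -> continuous (clampY k2 T Y).
Proof. by move=> T0 [Yx [Yxx [Yt [[cY _ _ _ _] _ _ _ _]]]]; exact: clampY_continuous. Qed.

(** The window has depth [2 * e <= eta / 2], so from the shrunk box it stays at distance [eta / 2]
    from the left wall and the initial time, hence outside the disc cut out around the corner.
    Looking backward, it also stays strictly below time [T], even for points at time [T]. *)
Lemma solution_approx (R : realType) (K1 k2 K2 sigma r q T p xl xr tb te : R)
    (Y : R * R -> R) :
  1 < p -> 0 < T -> strong_solution K1 k2 K2 sigma r q T p Y ->
  ln k2 <= xl -> 0 <= tb -> te <= T -> forall eta, 0 < eta ->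
  exists2 F : R * R -> R, continuous F &
    forall z, box (xl + eta) (xr - eta) (tb + eta) te z ->
      `|F z - Y z| <= eta /\ exists v, [/\ heat_at sigma r q F z v, 0 <= v &
        (forall y, box (z.1 - eta) z.1 (z.2 - eta) z.2 y ->
           psi2 K1 k2 K2 y.1 < Y y) -> v = 0].
Proof.
move=> p1 T0 hY hxl htb hte eta eta0.
have cW := strong_solution_continuous T0 hY.
have [del del0 Hdel] := compact_unif_continuous (@box_compact R xl xr tb te) cW eta0.
pose e := Num.min del eta / 4.
have m0 : 0 < Num.min del eta by rewrite lt_min del0.
have e0 : 0 < e by rewrite divr_gt0.
have ed : 4 * e <= del by rewrite /e mulrC divfK// ge_min lexx.
have ee : 4 * e <= eta by rewrite /e mulrC divfK// ge_min lexx orbT.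
clearbody e.
have [k [sk k0 k1]] := mollifierP e0.
pose M := `|xl| + `|xr| + 1.
have M0 : 0 < M by rewrite ltr_pwDr// addr_ge0.
have rho0 : 0 < eta / 2 by lra.
have [iu H] := strong_solution_moll p1 hY M0 rho0.
set D := Q_cut k2 K2 T M (eta / 2) in iu H.
exists (moll (Y \_ D) k); first exact: moll_continuous iu sk.
case=> x t Bz.
have [/= bx bt] := Bz.
have BD : box (x - 2 * e) (x - e) (t - 2 * e) (t - e) `<=` D.
  case=> y s [/= by_ bs]; split => /=.
  - by lra.
  - have := ler_norm (- xl); have := ler_norm xr; rewrite normrN /M.
    have := normr_ge0 xl; have := normr_ge0 xr; lra.
  - by lra.
  - rewrite ler_wpDl ?sqr_ge0// lerXn2r ?nnegrE; lra.
have Bxt : box xl xr tb te (x, t) by split => /=; lra.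
have Yz : clampY k2 T Y (x, t) = Y (x, t).
  by apply: clampYE; split => /=; lra.
split.
  apply: (moll_close iu sk k0 k1) => y /= By.
  have Dy := BD _ By; rewrite patchE mem_set//.
  have [/= b1 b2] := By.
  have Yy : clampY k2 T Y y = Y y by apply: clampYE; split => /=; lra.
  rewrite -Yy -Yz distrC; apply: ltW; apply: Hdel => //=.
    by rewrite ger0_norm; lra.
  by rewrite ger0_norm; lra.
have [v [hv v0 vY]] := H e k (x, t) sk k0 BD.
exists v; split => // HY; apply: vY => y [/= b1 b2]; apply: HY.
by split => /=; lra.
Qed.

Lemma stationary_approx (R : realType) (K1 k2 K2 sigma r q p xl xr : R)
    (V : R -> R) :
  1 < p -> stationary_solution K1 k2 K2 sigma r q p V ->
  ln k2 <= xl -> forall eta, 0 < eta ->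
  exists2 F : R * R -> R, continuous F &
    forall z, xl + eta <= z.1 <= xr - eta ->
      `|F z - V z.1| <= eta /\ exists2 v, heat_at sigma r q F z v & 0 <= v.
Proof.
move=> p1 hV hxl eta eta0.
have [cV _ _ _ _] := hV.
have cW : continuous (V \o (fun z : R * R => Num.max z.1 (ln k2))).
  apply: (continuous_within_comp cV (@continuous_max_fst R (ln k2))) => z.
  by rewrite /= le_max lexx orbT.
(* A one-point time interval is enough, because [V] is read as constant in time. *)
have [del del0 Hdel] := compact_unif_continuous (@box_compact R xl xr 0 0) cW eta0.
pose e := Num.min del eta / 4.
have m0 : 0 < Num.min del eta by rewrite lt_min del0.
have e0 : 0 < e by rewrite divr_gt0.
have ed : 4 * e <= del by rewrite /e mulrC divfK// ge_min lexx.
have ee : 4 * e <= eta by rewrite /e mulrC divfK// ge_min lexx orbT.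
clearbody e.
have [k [sk k0 k1]] := mollifierP e0.
have hc : ln k2 < xl + eta / 2 by lra.
have [iu H] := stationary_solution_moll xr p1 hV hc.
set D := `[_, _]%classic in iu H.
exists (moll1 (V \_ D) k); first exact: moll1_continuous iu sk.
case=> x t /= bx; split; last first.
  by apply: (H e k (x, t) sk k0) => /=; lra.
apply: (moll1_close iu sk k0 k1) => y /= By.
have Dy : D y by rewrite /D/= in_itv/=; lra.
rewrite patchE mem_set//.
have := Hdel (x, 0) (y, 0); rewrite /= !(max_idPl _); [|lra|lra].
move=> HH; rewrite distrC; apply/ltW/HH.
- by split => /=; lra.
- by rewrite ger0_norm; lra.
- by rewrite subrr normr0 ltW.
Qed.

Lemma heat_at_shift (R : realType) (sigma r q h : R) (F : R * R -> R) x t v :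
  heat_at sigma r q F (x, t + h) v ->
  heat_at sigma r q (fun z => F (z.1, z.2 + h)) (x, t) v.
Proof.
move=> [Ft [F1 [F2 [/= dt dx dxx ->]]]]; exists Ft, F1, F2; split => //=.
have := @is_derive_affine R (fun s => F (x, s)) 1 h Ft t; rewrite mul1r => /(_ dt).
rewrite mul1r (_ : (fun s => F (x, 1 * s + h)) = (fun s => F (x, s + h)))//.
by apply/funext => s; rewrite mul1r.
Qed.

(** Supersolutions in the sense of uniform approximation by smooth ones, on boxes shrunk everywhere
    but at the final time. Mollification puts both the time translates of [Y] and the function [V]
    into this class. *)
Definition approx_super {R : realType} (sigma r q xl xr tb te : R) (Z : R * R -> R)
    : Prop :=
  forall eta, 0 < eta -> exists2 F : R * R -> R, continuous F &
    forall z, box (xl + eta) (xr - eta) (tb + eta) te z ->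
      `|F z - Z z| <= eta /\ exists2 v, heat_at sigma r q F z v & 0 <= v.

(** The competitor splits into a rough part [Z], known through approximants, and a classical part
    [g] that carries the growth at infinity. *)
Lemma solution_le_supersolution (R : realType) (K1 k2 K2 sigma r q T p xr te : R)
    (Y Z : R * R -> R) (g g1 g2 : R -> R) :
  0 < r -> 1 < p -> 0 < T -> strong_solution K1 k2 K2 sigma r q T p Y ->
  te <= T -> continuous Z -> approx_super sigma r q (ln k2) xr 0 te Z ->
  (forall x, is_derive x (1 : R) g (g1 x)) ->
  (forall x, is_derive x (1 : R) g1 (g2 x)) ->
  (forall x, L_op sigma r q (g x) (g1 x) (g2 x) <= 0) ->
  (forall z, box (ln k2) xr 0 te z -> psi2 K1 k2 K2 z.1 <= Z z + g z.1) ->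
  (forall z, box (ln k2) xr 0 te z -> [\/ z.1 = ln k2, z.1 = xr | z.2 = 0] ->
     Y z <= Z z + g z.1) ->
  forall z, box (ln k2) xr 0 te z -> Y z <= Z z + g z.1.
Proof.
move=> r0 p1 T0 hY hte cZ aZ dg dg1 Lg psiZ bdZ z Bz.
have YW y : box (ln k2) xr 0 te y -> clampY k2 T Y y = Y y.
  by move=> [b1 b2]; apply: clampYE; split; lra.
have cg : continuous (fun z : R * R => g z.1).
  move=> y; apply: (@continuous_comp _ _ _ fst g); first exact: cvg_fst.
  by apply/differentiable_continuous/derivable1_diffP; have [] := dg y.1.
pose w z := clampY k2 T Y z - Z z - g z.1.
suff : w z <= 0 by rewrite /w YW//; lra.
have cw : continuous w.
  move=> y; apply: cvgB; last exact: cg.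
  by apply: cvgB; [exact: (strong_solution_continuous T0 hY)|exact: cZ].
apply: (parabolic_comparison (sigma := sigma) (q := q) r0 cw _ _ Bz).
  by move=> y By /(bdZ _ By); rewrite /w YW//; lra.
move=> eta eta0.
have eta20 : 0 < eta / 2 by lra.
have [FY cFY HFY] := solution_approx xr p1 T0 hY (lexx _) (lexx _) hte eta20.
have [FZ cFZ HFZ] := aZ _ eta20.
exists (FY \- FZ \- (fun z => g z.1 + 0 * z.2)).
  move=> y; apply: cvgB; first by apply: cvgB; [exact: cFY|exact: cFZ].
  have -> : (fun z : R * R => g z.1 + 0 * z.2) = (fun z => g z.1).
    by apply/funext => s; rewrite mul0r addr0.
  by rewrite mul0r addr0; exact: cg.
move=> y By.
have By2 : box (ln k2 + eta / 2) (xr - eta / 2) (0 + eta / 2) te y.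
  by case: By => b1 b2; split; lra.
have By0 : box (ln k2) xr 0 te y by case: By => b1 b2; split; lra.
have [c1 [vY [hvY _ vY0]]] := HFY _ By2.
have [c2 [vZ hvZ vZ0]] := HFZ _ By2.
split.
  rewrite /w YW//= mul0r addr0.
  have -> : FY y - FZ y - g y.1 - (Y y - Z y - g y.1) = (FY y - Y y) - (FZ y - Z y) by ring.
  by apply: le_trans (ler_normB _ _) _; lra.
move=> wpos.
have hs := heat_at_sep sigma r q 0 dg (dg1 y.1).
exists (vY - vZ - (0 - L_op sigma r q (g y.1 + 0 * y.2) (g1 y.1) (g2 y.1))).
  exact: heat_atB (heat_atB hvY hvZ) hs.
(* Positivity of [w] on the backward box puts [Y] above [Z + g], hence above the obstacle, so the
   equation for [Y] holds on the whole window. *)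
rewrite vY0.
  by have := Lg y.1; rewrite mul0r addr0; lra.
move=> s [b1 b2]; case: By => b3 b4.
have Bs : box (ln k2) xr 0 te s by split; lra.
have : 0 < w s by apply: wpos; split; lra.
by have := psiZ _ Bs; rewrite /w YW//; lra.
Qed.

Lemma psi2_le_solution (R : realType) (K1 k2 K2 sigma r q T p : R) (Y : R * R -> R) :
  0 < k2 -> k2 < K2 -> strong_solution K1 k2 K2 sigma r q T p Y ->
  forall x t, ln k2 <= x -> 0 <= t <= T -> psi2 K1 k2 K2 x <= Y (x, t).
Proof.
move=> k20 kK [_ [_ [_ [_ obs _ _ [ini bd]]]]] x t.
rewrite le_eqVlt => /orP[/eqP <- tT|lx /andP[]].
  have [_ _ H] := psi2_cases K1 k2 K2 (ln k2); rewrite bd//; apply: H; first lra.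
  by rewrite lnK//; lra.
rewrite le_eqVlt => /orP[/eqP <- _|t0 tT]; first by rewrite ini.
by apply: (obs (x, t)); split => //=; rewrite t0.
Qed.

(* The barrier [del * exp (n2 x)] is annihilated by the operator and beats the
   bounded function [Y] at infinity. *)
Lemma solution_le (R : realType) (K1 k2 K2 sigma r q T p te n2 : R)
    (Y Z : R * R -> R) :
  0 < r -> 1 < p -> 0 < T -> 0 < K1 -> K1 < k2 ->
  char_root sigma r q n2 -> 0 < n2 ->
  bounded_strong_solution K1 k2 K2 sigma r q T p Y ->
  te <= T -> continuous Z ->
  (forall xr, approx_super sigma r q (ln k2) xr 0 te Z) ->
  (forall x t, ln k2 <= x -> 0 <= t <= te -> psi2 K1 k2 K2 x <= Z (x, t)) ->
  (forall t, 0 <= t <= te -> K2 - K1 <= Z (ln k2, t)) ->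
  forall x t, ln k2 <= x -> 0 <= t <= te -> Y (x, t) <= Z (x, t).
Proof.
move=> r0 p1 T0 K10 Kk hn2 n20 [hY [M YM]] hte cZ aZ psiZ bdZ x t lx t0.
rewrite leNgt; apply/negP => ZY.
(* Instead of letting the factor tend to zero, it is fixed so that the barrier at [x] is half the
   assumed excess; that already contradicts the comparison. The wall [xr] is placed where the
   barrier has overtaken the bound [M]. *)
pose d := (Y (x, t) - Z (x, t)) / (2 * expR (n2 * x)).
have d0 : 0 < d by rewrite divr_gt0 ?mulr_gt0 ?expR_gt0//; lra.
have [xr xxr Mxr] := expR_grows M x d0 n20.
pose E m x := m * expR (n2 * (x - 0)).
have dE m y : is_derive y (1 : R) (E m) (E (m * n2) y).
  have H : is_derive y (1 : R) (E m) _ := is_deriveZ m (is_derive_expRM n2 0 y).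
  by apply: (is_derive_eq H); rewrite /E /GRing.scale/= mulrA.
have Eg y : 0 <= E d y by rewrite mulr_ge0 ?expR_ge0// ltW.
have [_ [_ [_ [_ _ _ _ [ini bd]]]]] := hY.
have Bz : box (ln k2) xr 0 te (x, t) by split => //=; rewrite lx.
suff : Y (x, t) <= Z (x, t) + E d x.
  rewrite /E subr0 /d.
  have -> : (Y (x, t) - Z (x, t)) / (2 * expR (n2 * x)) * expR (n2 * x) =
      (Y (x, t) - Z (x, t)) / 2.
    by rewrite invfM mulrA divfK// gt_eqF// expR_gt0.
  lra.
apply: (solution_le_supersolution (g := E d) r0 p1 T0 hY hte cZ (aZ xr)
  (dE d) (dE (d * n2)) _ _ _ Bz).
- move=> y; have := L_op_expR (E d y) hn2.
  have -> : n2 * E d y = E (d * n2) y by rewrite /E; ring.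
  have -> : n2 * E (d * n2) y = E (d * n2 * n2) y by rewrite /E; ring.
  by move->.
- by case=> y s [/= /andP[b1 _] b2]; rewrite ler_wpDr ?psiZ.
- case=> y s [/= /andP[b1 b1'] b2]; have sT : 0 <= s <= T by lra.
  have pz := psiZ y s b1 b2.
  case => /= e.
  + by rewrite e bd// ler_wpDr ?bdZ.
  + rewrite e in b1 pz *.
    have [h1 _ _] := psi2_cases K1 k2 K2 xr.
    have : Y (xr, s) <= M by apply: le_trans (ler_norm _) _; apply: YM; split.
    by rewrite /E subr0; lra.
  + move: b1; rewrite le_eqVlt => /orP[/eqP yl|ly].
      by rewrite -yl bd// ler_wpDr ?bdZ.
    by rewrite e in pz *; rewrite ini// ler_wpDr.
Qed.

(** Operator, obstacle and lateral value do not depend on time, so the translate by [h] is again a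
    supersolution above the obstacle, and it starts above [psi2], the initial value of [Y]. *)
Lemma solution_nondecreasing (R : realType) (K1 k2 K2 sigma r q T p n2 h : R)
    (Y : R * R -> R) :
  0 < r -> 1 < p -> 0 < T -> 0 < K1 -> K1 < k2 -> k2 < K2 ->
  char_root sigma r q n2 -> 0 < n2 ->
  bounded_strong_solution K1 k2 K2 sigma r q T p Y -> 0 <= h ->
  forall x t, ln k2 <= x -> 0 <= t -> t + h <= T -> Y (x, t) <= Y (x, t + h).
Proof.
move=> r0 p1 T0 K10 Kk kK hn2 n20 hb h0 x t lx t0 thT.
have [hY [M YM]] := hb.
have k20 : 0 < k2 by lra.
have [_ [_ [_ [_ _ _ _ [_ bd]]]]] := hY.
pose Z z := clampY k2 T Y (z.1, z.2 + h).
have YZ y s : ln k2 <= y -> 0 <= s <= T - h -> Z (y, s) = Y (y, s + h).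
  by move=> ly sT; rewrite /Z clampYE//; split => //=; lra.
have cs : continuous (fun z : R * R => (z.1, z.2 + h)).
  move=> z; apply: (@cvg_pair _ _ _ (nbhs z) (nbhs z.1) (nbhs (z.2 + h)) _ _ _
    (fun z : R * R => z.1) (fun z : R * R => z.2 + h)).
    exact: cvg_fst.
  by apply: cvgD; [exact: cvg_snd|exact: cvg_cst].
have cZ : continuous Z.
  move=> z; apply: (@continuous_comp _ _ _ _ (clampY k2 T Y)); first exact: cs.
  exact: (strong_solution_continuous T0 hY).
rewrite -YZ//; last by lra.
apply: (solution_le (te := T - h) r0 p1 T0 K10 Kk hn2 n20 hb _ cZ) => //.
- by lra.
- move=> xr eta eta0.
  have [F cF HF] := solution_approx xr p1 T0 hY (lexx _) h0 (lexx T) eta0.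
  exists (fun z => F (z.1, z.2 + h)).
    by move=> z; apply: (@continuous_comp _ _ _ _ F); [exact: cs|exact: cF].
  case=> y s [/= b1 b2].
  have [|c1 [v [hv v0 _]]] := HF (y, s + h); first by split => /=; lra.
  rewrite YZ; [|lra|lra]; split => //.
  by exists v => //; exact: heat_at_shift.
- move=> y s ly sT; rewrite YZ//.
  by apply: (psi2_le_solution k20 kK hY) => //; lra.
- by move=> s sT; rewrite YZ ?bd//; lra.
- by lra.
Qed.

Lemma solution_le_stationary (R : realType) (K1 k2 K2 sigma r q T p n2 : R)
    (Y : R * R -> R) (V : R -> R) :
  0 < r -> 1 < p -> 0 < T -> 0 < K1 -> K1 < k2 ->
  char_root sigma r q n2 -> 0 < n2 ->
  bounded_strong_solution K1 k2 K2 sigma r q T p Y ->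
  stationary_solution K1 k2 K2 sigma r q p V ->
  forall x t, ln k2 <= x -> 0 <= t <= T -> Y (x, t) <= V x.
Proof.
move=> r0 p1 T0 K10 Kk hn2 n20 hb hV x t lx t0.
have [cV _ psiV Vk _] := hV.
pose Z := V \o (fun z : R * R => Num.max z.1 (ln k2)).
have cZ : continuous Z.
  apply: (continuous_within_comp cV (@continuous_max_fst R (ln k2))) => z.
  by rewrite /= le_max lexx orbT.
have VZ y s : ln k2 <= y -> Z (y, s) = V y by move=> ly; rewrite /Z /= (max_idPl ly).
rewrite -(VZ x t)//.
apply: (solution_le r0 p1 T0 K10 Kk hn2 n20 hb (lexx T) cZ) => //.
- move=> xr eta eta0.
  have [F cF HF] := stationary_approx xr p1 hV (lexx _) eta0.
  exists F => //; case=> y s [/= b1 b2].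
  by have := HF (y, s) b1; rewrite VZ//; lra.
- by move=> y s ly _; rewrite VZ// psiV.
- by move=> s _; rewrite VZ// Vk.
Qed.

Lemma approx_super0 (R : realType) (sigma r q xl xr tb te : R) :
  approx_super sigma r q xl xr tb te (fun=> 0).
Proof.
move=> eta eta0; exists (fun=> 0); first by move=> z; exact: cvg_cst.
move=> z _; split; first by rewrite subrr normr0 ltW.
exists 0 => //; exists 0, (fun=> 0), 0; split.
- exact: is_derive_cst.
- by move=> x; exact: is_derive_cst.
- exact: is_derive_cst.
- by rewrite /L_op; ring.
Qed.

(** The uncut profile grows like [expR (n2 * x)] and so exceeds the bound [M] of [Y] far out: it is
    its own barrier at infinity, and the rough part is zero. *)
Lemma solution_le_capped (R : realType) (K1 k2 K2 sigma r q T p n1 n2 a : R)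
    (Y : R * R -> R) :
  0 < r -> 1 < p -> 0 < T -> 0 < K1 -> K1 < k2 -> k2 < K2 ->
  char_root sigma r q n1 -> n1 < 0 -> char_root sigma r q n2 -> 0 < n2 ->
  bounded_strong_solution K1 k2 K2 sigma r q T p Y ->
  let g x := capped ((k2 - K1) / (n2 - n1)) n1 n2 (x - a) in
  (forall x, ln k2 <= x -> psi2 K1 k2 K2 x <= g x) ->
  forall x t, ln k2 <= x -> 0 <= t <= T -> Y (x, t) <= g x.
Proof.
move=> r0 p1 T0 K10 Kk kK hn1 n10 hn2 n20 [hY [M YM]] g psig x t lx t0.
have [_ [_ [_ [_ _ _ _ [ini bd]]]]] := hY.
have k20 : 0 < k2 by lra.
set c := (k2 - K1) / (n2 - n1) in g psig *.
have c0 : 0 < c by rewrite divr_gt0//; lra.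
have d0 : 0 < c * - n1 * expR (- (n2 * a)).
  by rewrite mulr_gt0 ?expR_gt0// mulr_gt0// oppr_gt0.
have [xr xxr Mxr] := expR_grows M x d0 n20.
have Bz : box (ln k2) xr 0 T (x, t) by split => //=; rewrite lx.
have := @solution_le_supersolution R K1 k2 K2 sigma r q T p xr T Y (fun=> 0)
  g _ _ r0 p1 T0 hY (lexx T) (fun z => cvg_cst _) (@approx_super0 _ _ _ _ _ _ _ _)
  (fun x => (is_derive_capped c n1 n2 a x).1)
  (fun x => (is_derive_capped c n1 n2 a x).2) _ _ _ _ Bz.
rewrite /= add0r; apply.
- by move=> y; rewrite /g L_op_capped.
- by case=> y s [/= /andP[b1 _] b2]; rewrite add0r psig.
- case=> y s [/= /andP[b1 b1'] b2]; rewrite add0r; case => /= e.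
  + rewrite e bd//; apply: le_trans (psig _ (lexx _)).
    have [_ h1 _] := psi2_cases K1 k2 K2 (ln k2); apply: le_trans h1.
    by rewrite lnK//; lra.
  + rewrite e; apply: (le_trans (ler_norm _)); apply: (@le_trans _ _ M).
      by apply: YM; split => //=; rewrite -e.
    apply: le_trans Mxr _; rewrite /g /capped.
    have -> : c * - n1 * expR (- (n2 * a)) * expR (n2 * xr) =
        c * - n1 * expR (n2 * (xr - a)).
      have -> : n2 * (xr - a) = - (n2 * a) + n2 * xr by ring.
      by rewrite expRD mulrA.
    have : 0 <= c * n2 * expR (n1 * (xr - a)).
      by rewrite mulr_ge0 ?expR_ge0// mulr_ge0// ltW.
    lra.
  + move: b1; rewrite le_eqVlt => /orP[/eqP yl|ly].
      rewrite -yl bd//; apply: le_trans (psig _ (lexx _)).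
      have [_ h1 _] := psi2_cases K1 k2 K2 (ln k2); apply: le_trans h1.
      by rewrite lnK//; lra.
    by rewrite e ini// psig// ltW.
Qed.

(** * Strict inequality at the kink *)

Definition parabola {R : realType} (K N s : R) : R := - (K / 4) * s + N / 2 * (s * s).

(** In [s = x - ln K2], the slope [- K / 4] at [0] lies strictly between the one-sided slopes [- K]
    and [0] of the obstacle. The relation [N * del = K / 4] keeps the quadratic term below half of
    the linear one on the interval. *)
Lemma parabola_bounds (R : realType) (K N del s : R) :
  0 < K -> 0 < N -> N * del = K / 4 -> 0 <= s <= del ->
  parabola K N s <= - (K / 8) * s /\ parabola K N (- s) <= 3 / 8 * K * s.
Proof.
move=> K0 N0 Nd /andP[s0 sd]; rewrite /parabola.
have : N * (s * s) <= K / 4 * s by rewrite mulrA ler_wpM2r// -Nd ler_wpM2l// ltW.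
by split; lra.
Qed.

Lemma expRN_chord (R : realType) (s : R) : 0 <= s <= 1 -> s / 2 <= 1 - expR (- s).
Proof.
move=> /andP[s0 s1].
suff : (expR s)^-1 <= 1 - s / 2 by rewrite expRN; lra.
rewrite -[leLHS]mul1r ler_pdivrMr ?expR_gt0//.
have : 0 <= (1 - s / 2) * (expR s - (1 + s)).
  by rewrite mulr_ge0 ?subr_ge0 ?expR_ge1Dx//; lra.
have : 0 <= s * (1 - s) by rewrite mulr_ge0 ?subr_ge0.
lra.
Qed.

Lemma parabola_le_kink (R : realType) (K N del s : R) :
  0 < K -> 0 < N -> del <= 1 -> N * del = K / 4 -> - del <= s <= del ->
  parabola K N s <= K * Num.max (1 - expR s) 0.
Proof.
move=> K0 N0 d1 Nd /andP[ds sd]; have [s0|s0] := leP s 0.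
  have s1 : 0 <= - s <= del by lra.
  have [_] := parabola_bounds K0 N0 Nd s1; rewrite opprK => h.
  have s2 : 0 <= - s <= 1 by lra.
  have := expRN_chord s2; rewrite opprK => h2.
  apply: le_trans h _; apply: (@le_trans _ _ (K * (1 - expR s))).
    by rewrite [3 / 8 * K]mulrC -mulrA ler_pM2l//; lra.
  by rewrite ler_pM2l// le_max lexx.
have s1 : 0 <= s <= del by lra.
have [h _] := parabola_bounds K0 N0 Nd s1; apply: le_trans h _.
apply: (@le_trans _ _ 0); last by rewrite mulr_ge0 ?le_max ?lexx ?orbT// ltW.
by have := mulr_ge0 (ltW K0) (ltW s0); clear; lra.
Qed.

(** At either end the slopes [- K / 8] and [3 / 8 * K] from [parabola_bounds] leave a margin of
    [K * del / 8] below the obstacle, by [expRN_chord] on the left. This margin pays for lifting the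
    parabola. *)
Lemma parabola_ends (R : realType) (K N del s : R) :
  0 < K -> 0 < N -> 0 < del <= 1 -> N * del = K / 4 -> s = del \/ s = - del ->
  parabola K N s + K * del / 8 <= K * Num.max (1 - expR s) 0.
Proof.
move=> K0 N0 /andP[d0 d1] Nd.
have d2 : 0 <= del <= del by rewrite lexx ltW.
have [h1 h2] := parabola_bounds K0 N0 Nd d2.
case=> ->.
  apply: (@le_trans _ _ 0); first by lra.
  by rewrite mulr_ge0 ?le_max ?lexx ?orbT// ltW.
apply: (@le_trans _ _ (K * (1 - expR (- del)))); last by rewrite ler_pM2l// le_max lexx.
have d3 : 0 <= del <= 1 by rewrite d1 ltW.
have := expRN_chord d3; rewrite -(ler_pM2l K0); lra.
Qed.

(** The slope stays below [K / 2] and the value below [c + K], uniformly in [N], so a large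
    curvature term dominates the rest. *)
Lemma parabola_subsolution (R : realType) (sigma r q K N del c kap h s : R) :
  0 < K -> 0 < N -> 0 < r -> 0 < del <= 1 -> N * del = K / 4 -> - del <= s <= del ->
  h <= 0 ->
  kap + `|r - q - sigma ^+ 2 / 2| * K / 2 + r * (c + K) <= sigma ^+ 2 / 2 * N ->
  kap - L_op sigma r q (c + K * del / 8 + h + parabola K N s) (- (K / 4) + N * s) N <= 0.
Proof.
move=> K0 N0 r0 /andP[d0 d1] Nd /andP[ds sd] h0 HN.
rewrite /L_op; set beta := r - q - sigma ^+ 2 / 2 in HN *.
have h2 : N * s <= N * del by rewrite ler_pM2l.
have h3 : N * - s <= N * del by rewrite ler_pM2l// lerNl.
have g1 : `|- (K / 4) + N * s| <= K / 2.
  by rewrite ler_norml; clear HN; apply/andP; split; lra.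
have betag : - (`|beta| * K / 2) <= beta * (- (K / 4) + N * s).
  have : `|beta * (- (K / 4) + N * s)| <= `|beta| * (K / 2) by rewrite normrM ler_wpM2l.
  by rewrite ler_norml => /andP[b1 _]; rewrite -mulrA; apply: le_trans b1.
have PK : parabola K N s <= 3 / 8 * K.
  have [s0|s0] := leP 0 s.
    have s1 : 0 <= s <= del by rewrite s0.
    have [p1 _] := parabola_bounds K0 N0 Nd s1; apply: (le_trans p1).
    have := mulr_ge0 (ltW K0) s0; clear HN betag; lra.
  have s1 : 0 <= - s <= del by rewrite lerNl ds oppr_ge0 ltW.
  have [_] := parabola_bounds K0 N0 Nd s1; rewrite opprK => p1; apply: (le_trans p1).
  have s2 : - s <= 1 by clear -ds d1; lra.
  by move: s2; rewrite -(ler_pM2l K0); clear; lra.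
have rU : r * (c + K * del / 8 + h + parabola K N s) <= r * (c + K).
  rewrite ler_pM2l//.
  have : K * del <= K by rewrite ler_piMr// ltW.
  clear HN betag; lra.
clear PK g1 h2 h3; lra.
Qed.

(** A small [del] makes [N = K / (4 * del)] large, while [del <= 1] bounds [kap + m] by a constant
    [C] free of [del]. The value of [kap] makes the lift vanish at time [tau / 2]. *)
Lemma kink_parameters (R : realType) (sigma K tau b m : R) :
  0 < sigma -> 0 < K -> 0 < tau -> 0 < b -> 0 <= m -> exists del N kap : R,
  [/\ 0 < del <= 1, del <= b, 0 < N, N * del = K / 4 &
    [/\ 0 < kap, kap * tau = K * del / 4 & kap + m <= sigma ^+ 2 / 2 * N]].
Proof.
move=> s0 K0 t0 b0 m0.
pose C := K / (4 * tau) + m.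
have C1 : 0 < K / (4 * tau) by rewrite divr_gt0// mulr_gt0.
have C0 : 0 < C by rewrite /C ltr_wpDr.
have sK : 0 < sigma ^+ 2 * K / (8 * C) by rewrite divr_gt0 ?mulr_gt0 ?exprn_gt0.
pose del := Num.min 1 (Num.min b (sigma ^+ 2 * K / (8 * C))).
have d0 : 0 < del by rewrite !lt_min ltr01 sK b0.
have d1 : del <= 1 by rewrite ge_min lexx.
have d2 : del <= b by rewrite !ge_min lexx !orbT.
have d3 : del <= sigma ^+ 2 * K / (8 * C) by rewrite !ge_min lexx !orbT.
exists del, (K / (4 * del)), (K * del / (4 * tau)).
clearbody del; split; rewrite ?d0 ?divr_gt0 ?mulr_gt0//.
  by field; rewrite gt_eqF.
split; first by rewrite ?divr_gt0 ?mulr_gt0.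
  by field; rewrite gt_eqF.
apply: (@le_trans _ _ C).
  by rewrite /C lerD2r ler_pM2r ?invr_gt0 ?mulr_gt0// ler_piMr// ltW.
move: d3; rewrite ler_pdivlMr ?mulr_gt0// => d3.
have -> : sigma ^+ 2 / 2 * (K / (4 * del)) = sigma ^+ 2 * K / 8 / del.
  by field; rewrite gt_eqF.
by rewrite ler_pdivlMr//; clear -d3; lra.
Qed.

Lemma is_derive_parabola (R : realType) (K N C X x : R) :
  is_derive x (1 : R) (fun x => C + parabola K N (x - X)) (- (K / 4) + N * (x - X)) /\
  is_derive x (1 : R) (fun x => - (K / 4) + N * (x - X)) N.
Proof.
have dB : is_derive x (1 : R) (fun x => x - X) 1.
  by have := is_deriveD (is_derive_id x (1 : R)) (is_derive_cst (- X) x 1); rewrite addr0.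
split.
  have H : is_derive x (1 : R) (fun x => C + parabola K N (x - X)) _ :=
    is_deriveD (is_derive_cst C x (1 : R))
      (is_deriveD (is_deriveZ (- (K / 4)) dB)
        (is_deriveZ (N / 2) (is_deriveM dB dB))).
  by apply: (is_derive_eq H); rewrite /GRing.scale/=; lra.
have H : is_derive x (1 : R) (fun x => - (K / 4) + N * (x - X)) _ :=
  is_deriveD (is_derive_cst (- (K / 4)) x (1 : R)) (is_deriveZ N dB).
by apply: (is_derive_eq H); rewrite /GRing.scale/=; lra.
Qed.

(* A parabola with a large second derivative fits under the convex kink of the
   obstacle at [ln K2] and is a strict subsolution there. *)
Lemma solution_gt_kink (R : realType) (K1 k2 K2 sigma r q T p : R)
    (Y : R * R -> R) :
  0 < r -> 1 < p -> 0 < T -> 0 < sigma -> 0 < K1 -> K1 < k2 -> k2 < K2 ->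
  strong_solution K1 k2 K2 sigma r q T p Y ->
  forall tau, 0 < tau <= T -> k2 - K1 < Y (ln K2, tau).
Proof.
move=> r0 p1 T0 s0 K10 Kk kK hY tau /andP[t0 tT].
have k20 : 0 < k2 by lra.
have K20 : 0 < K2 by lra.
have lnk : 0 < ln K2 - ln k2 by rewrite subr_gt0 ltr_ln.
have psiY := psi2_le_solution k20 kK hY.
have eX : expR (ln K2) = K2 by rewrite lnK.
have c0 : 0 < k2 - K1 by rewrite subr_gt0.
have obs x : psi2 K1 k2 K2 x = k2 - K1 + K2 * Num.max (1 - expR (x - ln K2)) 0.
  rewrite /psi2 expRB eX maxr_pMr ?ltW// mulr0 mulrBr mulr1 mulrCA divff ?gt_eqF// mulr1.
  by rewrite -addrA addrC.
set X := ln K2 in lnk eX obs *; set c := k2 - K1 in c0 obs *; clearbody X c.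
have m0 : 0 <= `|r - q - sigma ^+ 2 / 2| * K2 / 2 + r * (c + K2).
  by rewrite addr_ge0 ?divr_ge0 ?mulr_ge0 ?addr_ge0 ?normr_ge0// ltW.
have [del [N [kap [d01 d2 N0 Nd [kap0 kapt HN]]]]] := kink_parameters s0 K20 t0 lnk m0.
rewrite addrA in HN; have [d0 d1] := andP d01.
(* At time [tau] the parabola is lifted by [K2 * del / 8], which gives the strict inequality at the
   kink. The lift decreases backward to zero at [tau / 2], where the parabola fits under the
   obstacle. *)
pose g x := c + K2 * del / 8 - kap * tau + parabola K2 N (x - X).
pose U z := g z.1 + kap * z.2.
have dg x := (is_derive_parabola K2 N (c + K2 * del / 8 - kap * tau) X x).1.
have dg1 x := (is_derive_parabola K2 N (c + K2 * del / 8 - kap * tau) X x).2.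
have UE z : U z = c + K2 * del / 8 + kap * (z.2 - tau) + parabola K2 N (z.1 - X).
  by rewrite /U /g; ring.
have hx : ln k2 <= X - del by clear -d2; lra.
have ht : 0 <= tau / 2 by rewrite divr_ge0// ltW.
have inQ y : box (X - del) (X + del) (tau / 2) tau y -> ln k2 <= y.1 /\ 0 <= y.2 <= T.
  by move=> [/andP[b1 _] /andP[b3 b4]]; split; [|apply/andP; split];
    [exact: le_trans b1|exact: le_trans b3|exact: le_trans tT].
have YW y : box (X - del) (X + del) (tau / 2) tau y -> clampY k2 T Y y = Y y.
  by move=> /inQ[h1 h2]; apply: clampYE.
pose w z := U z - clampY k2 T Y z.
have cU : continuous U.
  move=> z; apply: cvgD; last by apply: cvgM; [exact: cvg_cst|exact: cvg_snd].
  apply: (@continuous_comp _ _ _ fst g); first exact: cvg_fst.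
  by apply/differentiable_continuous/derivable1_diffP; have [] := dg z.1.
have cw : continuous w.
  by move=> z; apply: cvgB; [exact: cU|exact: (strong_solution_continuous T0 hY)].
have Bz : box (X - del) (X + del) (tau / 2) tau (X, tau).
  by split; apply/andP; split => //=; clear -d0 t0; lra.
suff : w (X, tau) <= 0.
  rewrite /w YW// UE /= !subrr /parabola !mulr0 !addr0 subr_le0 => h.
  by apply: lt_le_trans h; rewrite ltrDl divr_gt0// mulr_gt0.
apply: (parabolic_comparison (sigma := sigma) (q := q) r0 cw _ _ Bz).
  move=> z B; have [h1 h2] := inQ _ B; rewrite /w YW// subr_le0.
  have [/andP[b1 b2] /andP[b3 b4]] := B => bz.
  have pY : psi2 K1 k2 K2 z.1 <= Y z by case: (z) h1 h2 => x t; exact: psiY.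
  apply: le_trans pY; rewrite obs UE -!addrA lerD2l.
  have kt : kap * (z.2 - tau) <= 0 by rewrite pmulr_rle0// subr_le0.
  have ends s : s = del \/ s = - del -> z.1 - X = s ->
      K2 * del / 8 + (kap * (z.2 - tau) + parabola K2 N (z.1 - X)) <=
        K2 * Num.max (1 - expR (z.1 - X)) 0.
    move=> hs ->; have := parabola_ends K20 N0 d01 Nd hs; clear -kt; lra.
  case: bz => e.
  - by apply: (ends (- del)); [right|rewrite e; ring].
  - by apply: (ends del); [left|rewrite e; ring].
  - have sB : - del <= z.1 - X <= del by clear -b1 b2; lra.
    have := parabola_le_kink K20 N0 d1 Nd sB.
    by rewrite e; clear -kapt; lra.
move=> eta eta0.
have [FY cFY HFY] := solution_approx (X + del) p1 T0 hY hx ht tT eta0.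
exists (U \- FY); first by move=> z; apply: cvgB; [exact: cU|exact: cFY].
move=> z Bz'; have B : box (X - del) (X + del) (tau / 2) tau z.
  by case: Bz' => b1 b2; clear -b1 b2 eta0; split; lra.
have [h1 [v [hv v0 _]]] := HFY _ Bz'; split.
  rewrite /w YW//=.
  have -> : U z - FY z - (U z - Y z) = - (FY z - Y z) by ring.
  by rewrite normrN.
move=> _.
have hs := heat_at_sep sigma r q kap dg (dg1 z.1).
exists (kap - L_op sigma r q (U z) (- (K2 / 4) + N * (z.1 - X)) N - v).
  exact: heat_atB hs hv.
rewrite UE subr_le0; apply: le_trans v0.
have [/andP[b1 b2] /andP[_ b4]] := B.
apply: (parabola_subsolution (q := q) K20 N0 r0 d01 Nd _ _ HN).
  by clear -b1 b2; lra.
by rewrite pmulr_rle0// subr_le0.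
Qed.

(** * Bounds on the solution and its free boundaries *)

Theorem proposition5p7 (R : realType)
    (K1 k1 k2 K2 sigma r q T p n1 n2 : R)
    (hK1 : 0 < K1) (hKk1 : K1 < k1) (hk12 : k1 < k2) (hkK2 : k2 < K2)
    (hsigma : 0 < sigma) (hr : 0 < r) (hq : 0 <= q) (hT : 0 < T) (hp : 1 < p)
    (hn1 : char_root sigma r q n1) (hn1_neg : n1 < 0)
    (hn2 : char_root sigma r q n2) (hn2_pos : 0 < n2)
    (Y : R * R -> R) (hY : bounded_strong_solution K1 k2 K2 sigma r q T p Y)
    (A B : R -> R)
    (hA : is_upper_boundary K1 k2 K2 T Y A)
    (hB : is_lower_boundary K1 k2 K2 T Y B)
    (V : R -> R) (hV : stationary_solution K1 k2 K2 sigma r q p V)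
    (a bk2 : R) (hab : stationary_boundaries K1 k2 K2 n1 n2 a bk2) :
  [/\ forall x tau : R, ln k2 <= x -> 0 <= tau <= T -> Y (x, tau) <= V x,
      forall tau : R, 0 < tau <= T -> ln K2 < A tau <= a,
      cvg (B s @[s --> 0^'+]) &
      forall tau : R, 0 < tau <= T ->
        bk2 <= B tau <= lim (B s @[s --> 0^'+])].
Proof.
have k20 : 0 < k2 by lra.
have K20 : 0 < K2 by lra.
have K1k2 : K1 < k2 by lra.
have [sY _] := hY.
have [psig ga /andP[kb bK] gb Ka] := barrierP hK1 K1k2 hkK2 hn1_neg hn2_pos hab.
have kK : ln k2 < ln K2 by rewrite ltr_ln.
have Yg := solution_le_capped hr hp hT hK1 K1k2 hkK2 hn1 hn1_neg hn2 hn2_pos hY psig.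
have Ypsi := psi2_le_solution k20 hkK2 sY.
have Ymon h h0 := solution_nondecreasing (h := h) hr hp hT hK1 K1k2 hkK2 hn2 hn2_pos hY h0.
(* At [B t] the solution equals the put branch at time [t]; monotonicity in time and the obstacle
   squeeze it to the same value at the earlier time [s], so [B t] competes in the maximum defining
   [B s]. *)
have Bmon s t : 0 < s -> s <= t -> t <= T -> B t <= B s.
  move=> s0 st tT.
  have [[/andP[b1 b2] b3] _] := hB t ltac:(lra).
  have [_] := hB s ltac:(lra); apply.
  split; first by rewrite b1.
  apply/eqP; rewrite eq_le -{1}b3; apply/andP; split.
    have st0 : 0 <= t - s by rewrite subr_ge0.
    have := Ymon _ st0 (B t) s b1 (ltW s0).
    by rewrite addrC subrK; apply.
  have [_ h _] := psi2_cases K1 k2 K2 (B t); apply: le_trans h _.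
  by apply: Ypsi => //; lra.
have Bub t : 0 < t <= T -> B t <= ln K2.
  by move=> tT; have [[/andP[_ ->] _] _] := hB t tT.
have cB : cvg (B s @[s --> 0^'+]).
  apply/cvg_ex; eexists.
  apply: (@nonincreasing_at_right_cvgr _ B 0 (BRight T)).
  - by rewrite bnd_simp.
  - move=> s t; rewrite !in_itv/= => /andP[s0 sT] /andP[t0 tT] st.
    exact: Bmon.
  - by exists (ln K2) => _ [s /= sI <-]; apply: Bub; rewrite in_itv in sI.
split => //.
- by move=> x tau lx tT; exact: (solution_le_stationary hr hp hT hK1 K1k2 hn2 hn2_pos hY hV).
- move=> tau tT; have [[A1 A2] A3] := hA tau tT; apply/andP; split.
    rewrite lt_neqAle A1 andbT; apply/eqP => e.
    have := solution_gt_kink hr hp hT hsigma hK1 K1k2 hkK2 sY tT.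
    by rewrite e A2 ltxx.
  (* The barrier meets the obstacle at [a], so [Y] is squeezed to [k2 - K1] and [a] competes in the
     minimum defining [A tau]. The same squeeze at [bk2] gives the lower bound for [B tau]. *)
  apply: A3; split => //; apply/eqP; rewrite eq_le -{1}ga; apply/andP; split.
    by apply: Yg; lra.
  have [h _ _] := psi2_cases K1 k2 K2 a; apply: le_trans h _.
  by apply: Ypsi; lra.
- move=> tau /andP[t0 tT]; apply/andP; split.
    have [_] := hB tau ltac:(lra); apply; split; first by rewrite kb.
    apply/eqP; rewrite eq_le -{1}gb; apply/andP; split.
      by apply: Yg => //; lra.
    have [_ h _] := psi2_cases K1 k2 K2 bk2; apply: le_trans h _.
    by apply: Ypsi => //; lra.
  apply: limr_ge => //; near=> s; apply: Bmon => //.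
  by near: s; exact: nbhs_right_le.
Unshelve. all: by end_near. Qed.
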